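(* There exist two sequences of downward closed and nested index sets $(\Lambda^u_N)_{N\ge1}$ and $(\Lambda^p_N)_{N\ge1}$, with indices $\nu\in\mathcal F$ corresponding to the $N$ largest Taylor coefficients $\|t^u_\nu\|_{\mathcal V}$ and $\|t^p_\nu\|_{\mathcal Q}$, respectively, such that the following holds. (i) Under the assumption that $(\|\kappa_j\|_{\mathcal K})_{j\ge1}\in\ell^s(\mathbb N)$, i.e. $\sum_{j\ge1}\|\kappa_j\|_{\mathcal K}^s<\infty$, for some $s\in(0,1)$, $$\sup_{y\in U}\|u(y)-T_{\Lambda^u_N}u(y)\|_{\mathcal V}\le\big\|(\|t^u_\nu\|_{\mathcal V})_{\nu\in\mathcal F}\big\|_{\ell^s_m(\mathcal F)}N^{-r(s)},\qquad\sup_{y\in U}\|p(y)-T_{\Lambda^p_N}p(y)\|_{\mathcal Q}\le\big\|(\|t^p_\nu\|_{\mathcal Q})_{\nu\in\mathcal F}\big\|_{\ell^s_m(\mathcal F)}N^{-r(s)}.$$ (ii) Under the assumption that there exists a sequence $\rho=(\rho_j)_{j\ge1}$ with $\rho_j>1$ such that $\sum_{j\ge1}\rho_j|\kappa_j(x)|\le\kappa_0(x)-\epsilon$ for all $x\in D$, for some $\theta<\epsilon<\kappa_{\min}$, and such that $(\rho_j^{-1})_{j\ge1}\in\ell^t(\mathbb N)$ for some $t\in(0,\infty)$, $$\sup_{y\in U}\|u(y)-T_{\Lambda^u_N}u(y)\|_{\mathcal V}\le\big\|(\|t^u_\nu\|_{\mathcal V})_{\nu\in\mathcal F}\big\|_{\ell^t_m(\mathcal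 F)}N^{-r(t)},\qquad\sup_{y\in U}\|p(y)-T_{\Lambda^p_N}p(y)\|_{\mathcal Q}\le\big\|(\|t^p_\nu\|_{\mathcal Q})_{\nu\in\mathcal F}\big\|_{\ell^t_m(\mathcal F)}N^{-r(t)}.$$ Here the dimension-independent convergence rate $r$ is given by $r(s)=\frac1s-1$, $s<1$ (so in (ii) the rate $r(t)$ is defined for $t<1$).
   Context: Spaces and problem. $D$ is the physical domain (an open bounded set in $\mathbb R^d$, $d=2,3$, with Lipschitz boundary). $\mathcal V,\mathcal Q$ are Hilbert spaces with duals $\mathcal V',\mathcal Q'$, and $\mathcal K$ is a separable Banach space, whose elements $\kappa$ are functions on $D$. Given $\kappa\in\mathcal K$, $f\in\mathcal V'$, $g\in\mathcal Q'$, the parametric saddle point problem is: find $(u,p)\in\mathcal V\times\mathcal Q$ such that $a(u,v;\kappa)+b(v,p)=f(v)$ for all $v\in\mathcal V$ and $b(u,q)=g(q)$ for all $q\in\mathcal Q$. Here $a(\cdot,\cdot;\kappa):\mathcal V\times\mathcal V\to\mathbb R$ is a parametric bilinear form and $b:\mathcal V\times\mathcal Q\to\mathbb R$ is a bilinear form. Let $\mathcal V^0=\{v\in\mathcal V:b(v,q)=0\ \forall q\in\mathcal Q\}$. Assumptions on the forms. There are constants $\gamma,\alpha>0$ independent of $\kappa$ and $\delta,\beta>0$ such that $a(w,v;\kappa)\le\gamma\|w\|_{\mathcal V}\|v\|_{\mathcal V}$ for all $w,v\in\mathcal V$; $b(v,q)\le\delta\|v\|_{\mathcal V}\|q\|_{\mathcal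 Q}$ for all $v\in\mathcal V,q\in\mathcal Q$; $a(v,v;\kappa)\ge\alpha\|v\|_{\mathcal V}^2$ for all $v\in\mathcal V^0$; and $\inf_{q\in\mathcal Q}\sup_{v\in\mathcal V}\frac{b(v,q)}{\|v\|_{\mathcal V}\|q\|_{\mathcal Q}}\ge\beta$. Affine structure of $a$. $a(w,v;\kappa)=a_0(w,v)+a_1(w,v;\kappa)$ for all $w,v\in\mathcal V$, where $a_1(w,v;\kappa)$ depends linearly on $\kappa$ and, for constants $c_1,C_1>0$ independent of $\kappa$ and any $\kappa\in\mathcal K$: $a_1(v,v;\kappa)\ge c_1\operatorname{ess\,inf}_{x\in D}|\kappa(x)|\,\|v\|_{\mathcal V}^2$ for all $v\in\mathcal V^0$; $a_1(w,v;\kappa)\le C_1\operatorname{ess\,sup}_{x\in D}|\kappa(x)|\,\|w\|_{\mathcal V}\|v\|_{\mathcal V}$ for all $w,v\in\mathcal V$; $a_1(w,v;\kappa)\le\frac12\big(a_1(w,w;|\kappa|)+a_1(v,v;|\kappa|)\big)$ for all $w,v\in\mathcal V$. Affine parametrization. $U=[-1,1]^{\mathbb N}$ and $\kappa(x,y)=\kappa_0(x)+\sum_{j\ge1}y_j\kappa_j(x)$ for $(x,y)\in D\times U$, with $\kappa_j\in\mathcal K$ for all $j\ge0$. There are constants $0<\theta<\Theta<\infty$ such that $\theta<\kappa_{\min}:=\inf_{(x,y)\in D\times U}\kappa(x,y)\le\sup_{(x,y)\in D\times U}\kappa(x,y)=:\kappa_{\max}<\Theta/2$, and such that the coercivity and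 continuity conditions above are satisfied for $a(\cdot,\cdot;\kappa)$ at any $\kappa\in[\theta,\Theta]$. $(u(y),p(y))$ denotes the unique solution of the saddle point problem at $\kappa=\kappa(\cdot,y)$. Taylor approximation. $\mathcal F$ is the set of finitely supported multi-indices $\nu=(\nu_j)_{j\ge1}$ of nonnegative integers, i.e. $|\nu|=\sum_j\nu_j<\infty$; $\nu!=\prod_{j\ge1}\nu_j!$ and $y^\nu=\prod_{j\ge1}y_j^{\nu_j}$, with $0!=1$ and $0^0=1$; $\partial^\nu$ is the mixed partial derivative of order $\nu$ in $y$. For $\psi=u,p$, the Taylor coefficients are $t^\psi_\nu=\frac1{\nu!}\partial^\nu\psi(0)$, and $T_\Lambda\psi(y)=\sum_{\nu\in\Lambda}t^\psi_\nu y^\nu$ for $\Lambda\subset\mathcal F$. The sets $\Lambda_N^u,\Lambda_N^p\subset\mathcal F$ have $N$ indices. Index sets and norms. $\mu\preceq\nu$ means $\mu_j\le\nu_j$ for all $j\ge1$. A set $\Lambda\subset\mathcal F$ is downward closed if $\nu\in\Lambda$ implies $\mu\in\Lambda$ for all $\mu\preceq\nu$; a sequence $(\Lambda_N)$ is nested if $\Lambda_N\subset\Lambda_{N+1}$. For a real sequence $(\theta_\nu)_{\nu\in\mathcal F}$ set $\theta^*_\nu=\max_{\nu\preceq\mu}\theta_\mu$ for $\nu\in\mathcal F$; if $(\theta^*_\nu)_{\nu\in\mathcal F}$ is $\ell^s(\mathcal F)$-summable, then $\|(\theta_\nu)_{\nu\in\mathcal F}\|_{\ell^s_m(\mathcal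 F)}=\|(\theta^*_\nu)_{\nu\in\mathcal F}\|_{\ell^s(\mathcal F)}$.
   Formalization: K is assumed continuously embedded in L^∞(D) (without a link between its norm and the functions, (i) fails), and ''N largest'' refers to the monotone envelopes of the Taylor coefficient norms, since the N largest norms themselves need not form a downward closed set. *)

(* Defs.v *)
From HB Require Import structures.
From mathcomp Require Import all_boot all_order all_algebra.
From mathcomp Require Import finmap sesquilinear.
From mathcomp Require Import all_classical all_reals all_analysis.

Set Implicit Arguments.
Unset Strict Implicit.
Unset Printing Implicit Defensive.

Import Order.TTheory GRing.Theory Num.Theory.
Import numFieldNormedType.Exports.

Local Open Scope classical_set_scope.
Local Open Scope ring_scope.

(* The index set of the parameters is nat = {0, 1, ...}: y j stands for
   y_{j+1}, and likewise for kappa_{j+1}, rho_{j+1} and nu_{j+1}. *)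

Section Domain.
Context {R : realType} {d : nat}.
Implicit Type D : set 'rV[R]_d.

(* Near each boundary point, and in suitable orthonormal coordinates y *m O,
   D is the strict epigraph, in the j-th coordinate, of a Lipschitz function of
   the other coordinates.  Balls and the Lipschitz condition refer to the
   maximum norm, which is equivalent to the Euclidean one. *)
Definition lipschitz_boundary D :=
  forall x, (closure D `\` D°) x ->
  exists (r L : R) (O : 'M[R]_d) (j : 'I_d) (phi : 'rV[R]_d.-1 -> R),
    [/\ 0 < r, O *m O^T = 1%:M, L.-lipschitz phi &
        forall y, ball x r y ->
          (D y <-> phi (col' j (y *m O)) < (y *m O) 0 j)].

(* Lebesgue null sets of R^d: countable covers by boxes of arbitrarily small
   total volume.  No measurability of N is required. *)
Definition lebesgue_null (N : set 'rV[R]_d) :=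
  forall e : R, 0 < e ->
  exists lo hi : nat -> 'rV[R]_d,
    [/\ forall k i, lo k 0 i <= hi k 0 i,
        N `<=` \bigcup_k [set x | forall i, lo k 0 i <= x 0 i <= hi k 0 i] &
        (\sum_(0 <= k <oo) (\prod_(i < d) (hi k 0 i - lo k 0 i))%:E <= e%:E)%E].

(* Same form as [ess_sup] and [ess_inf] of the library, which would require
   Lebesgue measure on R^d as an instance of [measure]. *)
Definition ess_sup_on D (h : 'rV[R]_d -> R) : \bar R :=
  ereal_inf [set M | lebesgue_null (D `&` [set x | ~ ((h x)%:E <= M)%E])].

Definition ess_inf_on D (h : 'rV[R]_d -> R) : \bar R :=
  ereal_sup [set M | lebesgue_null (D `&` [set x | ~ (M <= (h x)%:E)%E])].

End Domain.

Definition hilbert_norm {R : realType} (H : normedModType R) :=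
  exists ip : {bilinear H -> H -> R | *%R & *%R},
    (forall x y, ip x y = ip y x) /\ (forall x, ip x x = `|x| ^+ 2).

Definition separable_space (T : topologicalType) :=
  exists S : set T, countable S /\ dense S.

(* The elements of K are functions on D: [ev k x] is the value at x of the element k of K.  The last clause says that
   K embeds continuously in L^oo(D). *)
Definition function_space {R : realType} {d : nat} (D : set 'rV[R]_d)
    (K : normedModType R) (ev : K -> 'rV[R]_d -> R) :=
  [/\ forall x, D x -> scalar (ev^~ x),
      forall k, (forall x, D x -> ev k x = 0) -> k = 0 &
      exists C : R, forall k,
        (ess_sup_on D (fun x => (`|ev k x|)%R) <= (C * `|k|)%:E)%E].

Section Forms.
Context {R : realType} {V Q : normedModType R}.

Definition continuous_form (U W : normedModType R) (c : U -> W -> R) (C : R) :=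
  forall w v, c w v <= C * `|w| * `|v|.

Definition kernel_space (b : V -> Q -> R) : set V :=
  [set v | forall q, b v q = 0].

Definition coercive_on (A : set V) (c : V -> V -> R) (alpha : R) :=
  forall v, A v -> alpha * `|v| ^+ 2 <= c v v.

(* The quotient is only meaningful for v, q != 0. *)
Definition inf_sup_condition (b : V -> Q -> R) (beta : R) :=
  (beta%:E <= ereal_inf
     [set ereal_sup [set (b v q / (`|v| * `|q|))%:E | v in [set v | v != 0%R]]
     | q in [set q | q != 0%R]])%E.

Definition saddle_point_solution (c : V -> V -> R) (b : V -> Q -> R)
    (f : V -> R) (g : Q -> R) (u : V) (p : Q) :=
  (forall v, c u v + b v p = f v) /\ (forall q, b u q = g q).

End Forms.

Notation multi_index := {fsfun nat -> nat with 0%N}.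

Section MultiIndices.
Local Open Scope fset_scope.
Implicit Types nu mu : multi_index.

Definition mi_le mu nu := forall j, (mu j <= nu j)%N.

Definition mi_fact nu : nat := (\prod_(j <- finsupp nu) (nu j)`!)%N.

Definition mi_pow {R : realType} (y : nat -> R) nu : R :=
  \prod_(j <- finsupp nu) y j ^+ nu j.

Definition downward_closed (L : {fset multi_index}) :=
  forall nu mu, nu \in L -> mi_le mu nu -> mu \in L.

End MultiIndices.

Definition param_box {R : realType} : set (nat -> R) :=
  [set y | forall j, -1 <= y j <= 1].

Section Taylor.
Context {R : realType} {H : normedModType R}.
Implicit Types (psi : (nat -> R) -> H) (nu : multi_index).

Definition partial (j : nat) psi : (nat -> R) -> H :=
  fun y => derive1 (fun t : R => psi [eta y with j |-> t]) (y j).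

(* The order in which the variables are taken is that of the enumeration of the
   support; it is immaterial where psi is smooth. *)
Definition mixed_partial nu psi : (nat -> R) -> H :=
  foldr (fun j phi => iter (nu j) (partial j) phi) psi (enum_fset (finsupp nu)).

Definition taylor_coef psi nu : H :=
  ((mi_fact nu)%:R)^-1 *: mixed_partial nu psi (fun=> 0).

Definition taylor_sum psi (L : {fset multi_index}) (y : nat -> R) : H :=
  \sum_(nu <- L) mi_pow y nu *: taylor_coef psi nu.

Definition taylor_error psi (L : {fset multi_index}) : \bar R :=
  ereal_sup [set `|psi y - taylor_sum psi L y|%:E | y in param_box].

End Taylor.

Section Envelopes.
Context {R : realType}.
Implicit Types (theta : multi_index -> R) (L : nat -> {fset multi_index}).

(* A supremum in \bar R; it is attained when the envelope is summable. *)
Definition envelope theta (nu : multi_index) : \bar R :=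
  ereal_sup [set (theta mu)%:E | mu in [set mu | mi_le nu mu]].

(* Equal to +oo iff the envelope is not l^s-summable (s > 0). *)
Definition lm_norm (s : R) theta : \bar R :=
  ((\esum_(nu in [set: multi_index]) (envelope theta nu `^ s)) `^ s^-1)%E.

(* "Largest" is in terms of the envelope: a downward closed set of N indices
   carrying the N largest values of theta itself need not exist. *)
Definition largest_index_sets theta L :=
  forall N, (1 <= N)%N ->
    [/\ #|` L N| = N, downward_closed (L N), (L N `<=` L N.+1)%fset &
        forall nu mu, nu \in L N -> mu \notin L N ->
          (envelope theta mu <= envelope theta nu)%E].

Definition rate (s : R) : R := s^-1 - 1.

End Envelopes.

(* Main.v *)
(* The Taylor coefficients satisfy t_nu in V^0 for nu <> 0 and
     a(t_nu, v; kappa_0) + b(v, t^p_nu) = - sum_(j : nu_j > 0) a_1(t_(nu - e_j), v; kappa_j).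
   Testing with v = t_nu, the third condition on a_1 splits the right-hand side,
   and coercivity at kappa_0 - sum_j rho_j |kappa_j| absorbs it; summing over nu,
   sum_nu (rho^nu |t_nu|)^2 <= c with c independent of the weights rho, and the
   inf-sup condition transfers this to t^p.  No complex analysis is needed.
   Hence the envelope at nu is at most c' rho^(-nu) for every admissible rho >= 1,
   and rho may depend on nu.  With rho = 1 the squares are summable, so envelopes
   tend to 0 and the index sets can be chosen greedily without any assumption on
   (kappa_j).  In (ii), rho is fixed and sum_nu rho^(-t nu) is a product of
   geometric series; in (i), rho is adapted to nu.  The Taylor series converges to
   the solution because the residual of its truncations tends to 0, and the rate is
   Stechkin's inequality. *)
Require Import Defs.
From HB Require Import structures.
From mathcomp Require Import all_boot all_order all_algebra.
From mathcomp Require Import finmap sesquilinear.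
From mathcomp Require Import all_classical all_reals all_analysis.
From mathcomp Require Import ring lra.

Set Implicit Arguments.
Unset Strict Implicit.
Unset Printing Implicit Defensive.

Import Order.TTheory GRing.Theory Num.Theory.
Import numFieldNormedType.Exports.

Local Open Scope classical_set_scope.
Local Open Scope ring_scope.

(** * Boxes of multi-indices *)

(** [taylor_coef] is built from iterated [derive1], so nothing is known about it until the
    difference quotients are shown to converge. These solve perturbed saddle point problems, hence
    are bounded and then Cauchy; completeness of V and Q supplies the limit, and no existence
    theorem for saddle point problems enters. Partial derivatives are indexed by words of variables,
    since their commutation is part of what has to be proved. The weighted estimate closes because,
    for each variable j, every mu is nu - e_j for at most one nu: after summation the energies sum_j
    rho_j a_1(s, s; |kappa_j|), s = rho^nu t_nu, cancel on both sides, and only that of the zero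
    index is left. Unit weights are admissible because the signs y_j = - sgn kappa_j(x) turn the
    lower bound theta into sum_j |kappa_j(x)| <= kappa_0(x) - theta. In (i) the weights exceed 1 by
    amounts whose total effect on the form stays within half of the coercivity constant. *)

Section FfunMultiIndex.
Implicit Types (n j : nat).

Definition ffun_mi n (f : {ffun 'I_n -> 'I_n.+1}) : multi_index :=
  [fsfun j in seq_fset tt (iota 0 n) =>
     if insub j is Some i then f i : nat else 0%N].

Lemma ffun_miE n (f : {ffun 'I_n -> 'I_n.+1}) (i : 'I_n) : ffun_mi f i = f i.
Proof.
rewrite fsfunE seq_fsetE mem_iota ltn_ord insubT //= => lt_in.
by congr (nat_of_ord (f _)); exact: val_inj.
Qed.

Lemma ffun_mi_out n (f : {ffun 'I_n -> 'I_n.+1}) j : (n <= j)%N ->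
  ffun_mi f j = 0%N.
Proof. by move=> le_nj; rewrite fsfunE seq_fsetE mem_iota /= ltnNge le_nj. Qed.

Lemma ffun_mi_inj n : injective (@ffun_mi n).
Proof.
move=> f g /fsfunP fg; apply/ffunP => i; apply: val_inj.
by rewrite /= -!ffun_miE fg.
Qed.

End FfunMultiIndex.

(** One parameter bounds both the number of variables and the degree in each, so a single sequence
    of finite downward closed sets exhausts all multi-indices, and on each of them a sum of products
    is a product of sums. Locking prevents unfolding into an enumeration of functions. *)
HB.lock Definition mi_box (n : nat) : {fset multi_index} :=
  seq_fset tt [seq ffun_mi f | f <- enum {ffun 'I_n -> 'I_n.+1}].

Section Boxes.
Implicit Types (nu mu : multi_index) (n j : nat).

Lemma mi_boxP n nu : reflect
  ((forall j, (nu j <= n)%N) /\ (forall j, (n <= j)%N -> nu j = 0%N))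
  (nu \in mi_box n).
Proof.
rewrite mi_box.unlock seq_fsetE; apply: (iffP mapP) => /= [[f _ ->]|[nun nu0]].
  split=> j; last exact: ffun_mi_out.
  have [/ffun_mi_out -> //|lt_jn] := leqP n j.
  by rewrite (ffun_miE f (Ordinal lt_jn)) -ltnS.
exists [ffun i : 'I_n => inord (nu i)]; first by rewrite mem_enum.
apply/fsfunP => j; have [le_nj|lt_jn] := leqP n j.
  by rewrite nu0 // ffun_mi_out.
by rewrite (ffun_miE _ (Ordinal lt_jn)) ffunE inordK // ltnS.
Qed.

Lemma sum_mi_box (U : nmodType) (F : multi_index -> U) n :
  \sum_(nu <- mi_box n) F nu = \sum_(f : {ffun 'I_n -> 'I_n.+1}) F (ffun_mi f).
Proof.
rewrite mi_box.unlock (perm_big _ (seq_fset_perm _ _)) undup_id; last first.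
  by rewrite (map_inj_uniq (@ffun_mi_inj n)) enum_uniq.
by rewrite big_map big_enum.
Qed.

Lemma big_finsupp (T : Type) (idx : T) (op : Monoid.com_law idx)
    (h : nat -> nat -> T) nu n :
  (forall j, h j 0%N = idx) -> (forall j, (n <= j)%N -> nu j = 0%N) ->
  \big[op/idx]_(j <- finsupp nu) h j (nu j) = \big[op/idx]_(j < n) h j (nu j).
Proof.
move=> h0 nu0; rewrite -(big_mkord xpredT (fun j => h j (nu j))) /index_iota subn0.
rewrite [RHS](bigID (mem (finsupp nu))) /= [X in op _ X]big1 ?Monoid.mulm1.
  rewrite -[RHS]big_filter; apply: perm_big; apply: uniq_perm.
  - exact: fset_uniq.
  - by rewrite seq.filter_uniq ?iota_uniq.
  - move=> j; rewrite mem_filter mem_iota /= andbC add0n; case: ltnP => //= /nu0 e.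
    by rewrite mem_finsupp e eqxx.
by move=> j; case: finsuppP.
Qed.

Lemma sum_box_prod (T : comPzSemiRingType) (h : nat -> nat -> T) n :
  \sum_(nu <- mi_box n) \prod_(j < n) h j (nu j) =
  \prod_(j < n) \sum_(k < n.+1) h j k.
Proof.
rewrite sum_mi_box bigA_distr_bigA /=; apply: eq_bigr => f _.
by apply: eq_bigr => j _; rewrite ffun_miE.
Qed.

Lemma mi_box_le n m : (n <= m)%N -> {subset mi_box n <= mi_box m}.
Proof.
move=> le_nm nu /mi_boxP[nun nu0]; apply/mi_boxP; split=> j.
  exact: leq_trans le_nm.
by move=> /(leq_trans le_nm)/nu0.
Qed.

Lemma in_mi_box nu : exists n, nu \in mi_box n.
Proof.
exists (\sum_(j <- finsupp nu) (nu j + j.+1))%N.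
have ub j : j \in finsupp nu ->
    (nu j + j.+1 <= \sum_(j <- finsupp nu) (nu j + j.+1))%N.
  by move=> jnu; rewrite (big_fsetD1 j) //= leq_addr.
apply/mi_boxP; split=> j.
  case: (finsuppP nu j) => // /ub; exact: leq_trans (leq_addr _ _).
case: (finsuppP nu j) => // /ub le1 le2.
by have := leq_trans (leq_trans (leq_addl _ _) le1) le2; rewrite ltnn.
Qed.

Lemma seq_mi_box (s : seq multi_index) : exists n, {subset s <= mi_box n}.
Proof.
elim: s => [|x s [n sn]]; first by exists 0%N.
have [m xm] := in_mi_box x; exists (maxn n m) => y; rewrite !inE => /orP[/eqP ->|/sn].
  exact: mi_box_le (leq_maxr _ _) _ xm.
exact: mi_box_le (leq_maxl _ _) _.
Qed.

Lemma mi_box_down n : downward_closed (mi_box n).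
Proof.
move=> nu mu /mi_boxP[nun nu0] munu; apply/mi_boxP; split=> j.
  exact: leq_trans (nun j).
by move=> /nu0 e; have := munu j; rewrite e leqn0 => /eqP.
Qed.

Definition mi_succ nu j : multi_index := [fsfun nu with j |-> (nu j).+1].
Definition mi_pred nu j : multi_index := [fsfun nu with j |-> (nu j).-1].

Lemma mi_succE nu j k : mi_succ nu j k = ((j == k) + nu k)%N.
Proof. by rewrite fsfun_withE eq_sym; case: eqP => [->|]. Qed.

Lemma mi_predE nu j k : mi_pred nu j k = (nu k - (j == k))%N.
Proof. by rewrite fsfun_withE eq_sym; case: eqP => [->|]; rewrite ?subn1 ?subn0. Qed.

Lemma mi_predK nu j : (0 < nu j)%N -> mi_succ (mi_pred nu j) j = nu.
Proof.
move=> nuj; apply/fsfunP => k; rewrite mi_succE mi_predE.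
by case: eqP => [<-|]; rewrite ?subn0 // subnKC.
Qed.

Lemma mi_succK nu j : mi_pred (mi_succ nu j) j = nu.
Proof. by apply/fsfunP => k; rewrite mi_predE mi_succE addKn. Qed.

Lemma mi_succ_box n nu j : nu \in mi_box n ->
  (mi_succ nu j \in mi_box n) = (j < n)%N && (nu j < n)%N.
Proof.
move=> /mi_boxP[nun nu0]; apply/mi_boxP/andP => [[h1 h2]|[jn nujn]].
  have := h1 j; have := h2 j; rewrite !mi_succE eqxx => {}h2 ->; split=> //.
  by rewrite ltnNge; apply/negP => /h2.
split=> k; rewrite mi_succE; case: eqP => [<-//|_].
- exact: nun.
- by rewrite leqNgt jn.
- exact: nu0.
Qed.

Lemma mi_pred_box n nu j : nu \in mi_box n -> mi_pred nu j \in mi_box n.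
Proof.
by move=> /mi_box_down; apply=> k; rewrite mi_predE leq_subr.
Qed.

Lemma sum_mi_pred (U : nmodType) (F : multi_index -> U) n j : (j < n)%N ->
  \sum_(nu <- mi_box n | (0 < nu j)%N) F (mi_pred nu j) =
  \sum_(mu <- mi_box n | mi_succ mu j \in mi_box n) F mu.
Proof.
move=> jn; rewrite -big_filter -[RHS]big_filter.
rewrite -(big_map (fun nu => mi_pred nu j) xpredT F).
apply: perm_big; apply: uniq_perm.
- rewrite map_inj_in_uniq ?seq.filter_uniq ?fset_uniq // => nu mu.
  rewrite !mem_filter => /andP[nu0 _] /andP[mu0 _] e.
  by rewrite -(mi_predK nu0) e mi_predK.
- by rewrite seq.filter_uniq ?fset_uniq.
move=> mu; rewrite mem_filter; apply/mapP/andP => /= [[nu]|[smu bmu]].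
  rewrite mem_filter => /andP[nu0 nub] ->.
  by split; rewrite ?mi_predK //; exact: mi_pred_box.
by exists (mi_succ mu j); rewrite ?mi_succK // mem_filter smu mi_succE eqxx.
Qed.

Definition mi0 : multi_index := [fsfun].

Lemma mi0E j : mi0 j = 0%N.
Proof. by rewrite fsfunE. Qed.

Lemma mi_neq0 nu : nu != mi0 -> exists k, (0 < nu k)%N.
Proof.
move=> nu0; apply: contrapT => no; case/eqP: nu0; apply/fsfunP => j.
by rewrite mi0E; case E : (nu j) => [//|m]; case: no; exists j; rewrite E.
Qed.

Lemma mi0_box n : mi0 \in mi_box n.
Proof. by apply/mi_boxP; split=> j; rewrite mi0E. Qed.

Lemma mi_pow_box (R : realType) (y : nat -> R) nu n : nu \in mi_box n ->
  mi_pow y nu = \prod_(j < n) y j ^+ nu j.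
Proof. by move=> /mi_boxP[_ nun]; rewrite /mi_pow (@big_finsupp _ _ _ (fun j k => y j ^+ k) _ n). Qed.

Lemma mi_pow0 (R : realType) (y : nat -> R) : mi_pow y mi0 = 1.
Proof. by rewrite (mi_pow_box _ (mi0_box 0)) big_ord0. Qed.

Lemma mi_pow_ge0 (R : realType) (y : nat -> R) nu :
  (forall j, 0 <= y j) -> 0 <= mi_pow y nu.
Proof. by move=> y0; apply: prodr_ge0 => j _; rewrite exprn_ge0. Qed.

Lemma mi_pow_pred (R : realType) (y : nat -> R) nu j : (0 < nu j)%N ->
  mi_pow y nu = y j * mi_pow y (mi_pred nu j).
Proof.
move=> nuj; have [n nub] := in_mi_box nu; have /mi_boxP[_ nun] := nub.
have jn : (j < n)%N by rewrite ltnNge; apply: contraTN nuj => /nun ->.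
rewrite !(@mi_pow_box _ _ _ n) ?mi_pred_box //.
rewrite [LHS](bigD1 (Ordinal jn)) //= [in RHS](bigD1 (Ordinal jn)) //= mulrA; congr (_ * _).
  by rewrite mi_predE eqxx subn1 -exprS prednK.
by apply: eq_bigr => i ij; rewrite mi_predE (negbTE (_ : j != i)) ?subn0 // eq_sym.
Qed.

(** For fixed j, nu -> nu - e_j is injective where nu_j > 0 and stays in the box. This is the source
    of the cancellation in the energy estimate. *)
Lemma sum_mi_pred_le (R : realType) (F : multi_index -> nat -> R) n :
  (forall mu j, 0 <= F mu j) ->
  \sum_(nu <- mi_box n) \sum_(j < n | (0 < nu j)%N) F (mi_pred nu j) j <=
  \sum_(mu <- mi_box n) \sum_(j < n) F mu j.
Proof.
move=> F0; under eq_bigr do rewrite big_mkcond.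
rewrite exchange_big [leRHS]exchange_big; apply: ler_sum => j _.
rewrite -big_mkcond (sum_mi_pred (F^~ j) (ltn_ord j)) /= big_mkcond.
by apply: ler_sum => mu _; case: ifP.
Qed.

End Boxes.

(** * Parametric derivatives of saddle point solutions *)

Section SaddleStability.
Context {R : realType} {V Q : normedModType R}.
Implicit Types (b : {bilinear V -> Q -> R | *%R & *%R}).

Lemma continuous_form_norm (U W : normedModType R)
    (c : {bilinear U -> W -> R | *%R & *%R}) (C : R) :
  continuous_form c C -> forall w v, `|c w v| <= C * `|w| * `|v|.
Proof.
move=> cC w v; rewrite ler_norml cC andbT lerNl.
by have := cC (- w) v; rewrite linearNl normrN.
Qed.

Lemma inf_sup_bound (b : V -> Q -> R) beta q M :
  inf_sup_condition b beta -> 0 <= M -> (forall v, b v q <= M * `|v|) ->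
  beta * `|q| <= M.
Proof.
move=> hb M0 bM; have [->|q0] := eqVneq q 0; first by rewrite normr0 mulr0.
have nq : 0 < `|q| by rewrite normr_gt0.
rewrite -ler_pdivlMr // -lee_fin; apply: (le_trans hb).
apply: (@ge_ereal_inf _ _ _); exists (ereal_sup
  [set (b v q / (`|v| * `|q|))%:E | v in [set v | v != 0%R]]); first by exists q.
apply: ge_ereal_sup => _ [v /= v0 <-]; have nv : 0 < `|v| by rewrite normr_gt0.
by rewrite lee_fin invfM mulrA ler_pM2r ?invr_gt0 // ler_pdivrMr.
Qed.

(** Testing with x removes b, as x lies in the kernel; the inf-sup condition then bounds z through b
    v z = Phi v - c x v. It serves for uniqueness, for the difference quotients and for the
    truncation error of the Taylor series. *)
Lemma saddle_stability b (c : V -> V -> R) alpha gamma beta M x z (Phi : V -> R) :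
  0 < alpha -> 0 <= gamma -> 0 <= M ->
  inf_sup_condition b beta ->
  (forall w v, `|c w v| <= gamma * `|w| * `|v|) ->
  coercive_on (kernel_space b) c alpha ->
  kernel_space b x ->
  (forall v, c x v + b v z = Phi v) -> (forall v, `|Phi v| <= M * `|v|) ->
  alpha * `|x| <= M /\ beta * `|z| <= M + gamma * `|x|.
Proof.
move=> a0 g0 M0 hb hc ac kx eqx PhiM; split.
  have [->|x0] := eqVneq x 0; first by rewrite normr0 mulr0.
  have nx : 0 < `|x| by rewrite normr_gt0.
  rewrite -(ler_pM2r nx) -mulrA -expr2; apply: le_trans (ac _ kx) _.
  by have := eqx x; rewrite kx addr0 => ->; apply: le_trans (PhiM _); exact: ler_norm.
apply: (inf_sup_bound hb) => [|v]; first by rewrite addr_ge0 ?mulr_ge0.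
have -> : b v z = Phi v - c x v by rewrite -eqx addrAC subrr add0r.
rewrite mulrDl; apply: lerD.
  exact: le_trans (ler_norm _) (PhiM _).
by apply: le_trans (hc _ _); rewrite -normrN ler_norm.
Qed.

End SaddleStability.

(** * Derivatives of functions of one real variable *)

Section HasDeriv.
Context {R : realType}.

(** [derive1] has a value even where no derivative exists; this predicate asserts that the limit
    exists. *)
Definition has_deriv (H : normedModType R) (f : R -> H) (a : R) (l : H) :=
  forall e : R, 0 < e -> exists2 dl : R, 0 < dl &
    forall h : R, h != 0 -> `|h| < dl -> `|h^-1 *: (f (h + a) - f a) - l| <= e.

Lemma has_deriv_cvg (H : normedModType R) (f : R -> H) (a : R) (l : H) :
  has_deriv f a l -> (fun h => h^-1 *: (f (h + a) - f a)) @ 0^' --> l.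
Proof.
move=> fl; apply/cvgrPdist_le => e e0; have [dl dl0 H0] := fl e e0.
near=> h; rewrite distrC; apply: H0.
- by near: h; exact: nbhs_dnbhs_neq.
- near: h; apply: dnbhs0_lt => //.
Unshelve. all: by end_near. Qed.

Lemma has_deriv1 (H : normedModType R) (f : R -> H) (a : R) (l : H) :
  has_deriv f a l -> derive1 f a = l.
Proof. by move=> /has_deriv_cvg/cvg_lim; apply; exact: norm_hausdorff. Qed.

Lemma has_deriv_cauchy (H : completeNormedModType R) (f : R -> H) (a : R) :
  (forall e : R, 0 < e -> exists2 dl : R, 0 < dl &
     forall h k : R, h != 0 -> `|h| < dl -> k != 0 -> `|k| < dl ->
       `|h^-1 *: (f (h + a) - f a) - k^-1 *: (f (k + a) - f a)| <= e) ->
  exists l, has_deriv f a l.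
Proof.
move=> hc; set D := fun h => h^-1 *: (f (h + a) - f a).
have /cauchy_cvg : cauchy (D @ 0^').
  apply: cauchy_exP => e e0; have [dl dl0 H0] := hc (e / 2) ltac:(lra).
  have dl2 : 0 < dl / 2 by rewrite divr_gt0.
  exists (D (dl / 2)); suff : \forall h \near (0 : R)^', ball (D (dl / 2)) e (D h) by [].
  near=> h; rewrite -ball_normE /=.
  apply: le_lt_trans (_ : e / 2 < e); last by lra.
  apply: H0.
  - by rewrite gt_eqF.
  - by rewrite gtr0_norm //; lra.
  - by near: h; exact: nbhs_dnbhs_neq.
  - by near: h; apply: dnbhs0_lt.
move=> /cvg_ex[l Dl]; exists l => e e0.
have /cvgrPdist_le/(_ e e0) := Dl.
rewrite /dnbhs near_withinE => /nbhs_ballP[dl /= dl0 H0].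
exists dl => // h h0 hdl; rewrite distrC; apply: H0 => //.
by rewrite -ball_normE /= sub0r normrN.
Unshelve. all: by end_near. Qed.

End HasDeriv.

(** The difference quotients lie in the kernel of b, because G does not vary, and solve a saddle
    point problem for A + h B. Stability bounds them uniformly in h, so the terms h B(Dw h) tend to
    0; stability for A, applied to the difference of two quotients, then makes them Cauchy. [F'] is
    the derivative of F in the dual norm. *)
Lemma saddle_deriv (R : realType) (V Q : completeNormedModType R)
    (A B : {bilinear V -> V -> R | *%R & *%R}) (b : {bilinear V -> Q -> R | *%R & *%R})
    (alpha gamma beta C delta M d0 x : R)
    (w : R -> V) (r : R -> Q) (F : R -> V -> R) (F' : V -> R) (G : Q -> R) :
  0 < alpha -> 0 <= gamma -> 0 < beta -> 0 <= C -> 0 <= M -> 0 <= delta -> 0 < d0 ->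
  inf_sup_condition b beta -> continuous_form b delta ->
  continuous_form B C ->
  (forall h : R, `|h| < d0 ->
     continuous_form (fun w v => A w v + h * B w v) gamma /\
     coercive_on (kernel_space b) (fun w v => A w v + h * B w v) alpha) ->
  (forall h : R, `|h| < d0 -> forall v,
     A (w (h + x)) v + h * B (w (h + x)) v + b v (r (h + x)) = F (h + x) v) ->
  (forall h : R, `|h| < d0 -> forall q, b (w (h + x)) q = G q) ->
  (forall v, `|F' v| <= M * `|v|) ->
  (forall e : R, 0 < e -> exists2 dl : R, 0 < dl & forall h : R, h != 0 -> `|h| < dl ->
     forall v, `|h^-1 * (F (h + x) v - F x v) - F' v| <= e * `|v|) ->
  exists w' r', [/\ has_deriv w x w', has_deriv r x r',
    forall v, A w' v + b v r' = F' v - B (w x) v & forall q, b w' q = 0].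
Proof.
move=> a0 g0 be0 C0 M0 dt0 d00 hb bdt Bc Ahc weq beq F'M FF'.
have d00' : `|0 : R| < d0 by rewrite normr0.
have Ac : continuous_form A gamma.
  by move=> z v; have := (Ahc 0 d00').1 z v; rewrite mul0r addr0.
have Aco : coercive_on (kernel_space b) A alpha.
  by move=> v /((Ahc 0 d00').2 v); rewrite mul0r addr0.
have Acn := continuous_form_norm Ac; have Bcn := continuous_form_norm Bc.
have bcn := continuous_form_norm bdt.
pose Dw (h : R) := h^-1 *: (w (h + x) - w x); pose Dr h := h^-1 *: (r (h + x) - r x).
pose dF (h : R) v := h^-1 * (F (h + x) v - F x v).
have kDw (h : R) : `|h| < d0 -> kernel_space b (Dw h).
  move=> hd q; rewrite /Dw linearZl_LR linearBl beq //.
  by have := beq 0 d00' q; rewrite add0r => ->; rewrite subrr mulr0.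
have eq0 v : A (w x) v + b v (r x) = F x v.
  by have := weq 0 d00' v; rewrite add0r mul0r addr0.
have eqD (h : R) v : h != 0 -> `|h| < d0 ->
    A (Dw h) v + b v (Dr h) = dF h v - B (w x) v - h * B (Dw h) v.
  move=> h0 hd; have := weq h hd v; rewrite /Dw /Dr /dF => <-; rewrite -eq0.
  rewrite !linearZl_LR linearZr_LR !linearBl linearBr /=; field => //.
(* [M1] bounds the dual norm of [dF h - B (w x)] once [dF h] is within 1 of [F']. *)
set M1 := M + 1 + C * `|w x|.
have M10 : 0 <= M1 by rewrite !addr_ge0 // mulr_ge0.
have [d1 d10 H1] := FF' 1 ltr01.
have dFM (h : R) v : h != 0 -> `|h| < d1 -> `|dF h v| <= (M + 1) * `|v|.
  move=> h0 hd; rewrite -[dF h v](subrK (F' v)); apply: (le_trans (ler_normD _ _)).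
  by rewrite addrC mulrDl mul1r lerD // -[leRHS]mul1r H1.
have DwM (h : R) : h != 0 -> `|h| < d0 -> `|h| < d1 -> `|Dw h| <= M1 / alpha.
  move=> h0 hd hd1; rewrite ler_pdivlMr // mulrC.
  have [Ahn Aho] := Ahc h hd.
  have Ahn' z v : `|A z v + h * B z v| <= gamma * `|z| * `|v|.
    rewrite ler_norml Ahn andbT lerNl.
    by have := Ahn (- z) v; rewrite !linearNl normrN mulrN opprD.
  apply: (proj1 (@saddle_stability _ _ _ b _ alpha gamma beta M1 (Dw h) (Dr h)
    (fun v => dF h v - B (w x) v) a0 g0 M10 hb Ahn' Aho (kDw h hd) _ _)) => v.
    by rewrite addrAC eqD // subrK.
  apply: (le_trans (ler_normB _ _)); rewrite mulrDl lerD //; exact: dFM.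
have stab (h k e : R) : 0 <= e -> h != 0 -> `|h| < d0 -> `|h| < d1 ->
    k != 0 -> `|k| < d0 -> `|k| < d1 ->
    (forall v, `|dF h v - dF k v| <= e * `|v|) ->
    let E := e + (`|h| + `|k|) * (C * (M1 / alpha)) in
    alpha * `|Dw h - Dw k| <= E /\ beta * `|Dr h - Dr k| <= E + gamma * `|Dw h - Dw k|.
  move=> e0 h0 hd hd1 k0 kd kd1 dFe E.
  have MA : 0 <= M1 / alpha by rewrite divr_ge0 // ltW.
  apply: (@saddle_stability _ _ _ b A alpha gamma beta E (Dw h - Dw k) (Dr h - Dr k)
    (fun v => dF h v - dF k v - (h * B (Dw h) v - k * B (Dw k) v))) => //.
  - by rewrite /E addr_ge0 // mulr_ge0 ?addr_ge0 // mulr_ge0.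
  - by move=> q; rewrite linearBl !kDw // subrr.
  - move=> v; rewrite linearBl linearBr /=.
    have := eqD h v h0 hd; have := eqD k v k0 kd; lra.
  move=> v; apply: (le_trans (ler_normB _ _)); rewrite mulrDl lerD //.
  rewrite mulrDl [leRHS]mulrDl.
  have t (m : R) : m != 0 -> `|m| < d0 -> `|m| < d1 ->
      `|m| * `|B (Dw m) v| <= `|m| * (C * (M1 / alpha)) * `|v|.
    move=> *; rewrite -mulrA ler_wpM2l //; apply: (le_trans (Bcn _ _)).
    by rewrite ler_wpM2r // ler_wpM2l // DwM.
  apply: (le_trans (ler_normB _ _)); rewrite !normrM; apply: lerD; exact: t.
pose CC := C * (M1 / alpha).
have CC0 : 0 <= CC by rewrite mulr_ge0 // divr_ge0 // ltW.
have cau (e : R) : 0 < e -> exists2 dl : R, 0 < dl & forall h k : R,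
    h != 0 -> `|h| < dl -> k != 0 -> `|k| < dl ->
    alpha * `|Dw h - Dw k| <= e /\ beta * `|Dr h - Dr k| <= e + gamma * `|Dw h - Dw k|.
  move=> e0; have [d2 d20 H2] := FF' (e / 4) ltac:(lra).
  (* Half of e is reserved for the terms h B(Dw h) and k B(Dw k), the other half for [dF h - dF k];
     the summand 1 keeps the denominator positive. *)
  pose d3 := e / (4 * (CC + 1)).
  have d30 : 0 < d3 by rewrite divr_gt0 // mulr_gt0 // ltr_wpDl.
  exists (Order.min (Order.min d0 d1) (Order.min d2 d3)).
    by rewrite !lt_min d00 d10 d20.
  move=> h k h0; rewrite !lt_min => /andP[/andP[h1 h2] /andP[h3 h4]] k0.
  move=> /andP[/andP[k1 k2] /andP[k3 k4]].
  have E : e / 2 + (`|h| + `|k|) * CC <= e.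
    have : (`|h| + `|k|) * CC <= (d3 + d3) * (CC + 1).
      by apply: ler_pM; rewrite ?addr_ge0 //; [apply: lerD; exact: ltW | lra].
    have -> : (d3 + d3) * (CC + 1) = e / 2.
      by rewrite /d3; field; rewrite gt_eqF // ltr_wpDl.
    by lra.
  have [] := stab h k (e / 2) ltac:(lra) h0 h1 h2 k0 k1 k2.
    move=> v; have := H2 h h0 h3 v; have := H2 k k0 k3 v.
    rewrite -!/(dF _ v) => t1 t2.
    have -> : dF h v - dF k v = (dF h v - F' v) - (dF k v - F' v) by ring.
    apply: (le_trans (ler_normB _ _)).
    by lra.
  rewrite -/CC => s1 s2; split; first exact: le_trans s1 E.
  by apply: (le_trans s2); rewrite lerD2r.
have [w' ww'] : exists w', has_deriv w x w'.
  apply: has_deriv_cauchy => e e0.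
  have [dl dl0 H] := cau (alpha * e) (mulr_gt0 a0 e0).
  exists dl => // h k h0 hd k0 kd; have [+ _] := H h k h0 hd k0 kd.
  by rewrite ler_pM2l.
have [r' rr'] : exists r', has_deriv r x r'.
  apply: has_deriv_cauchy => e e0.
  (* The error in r is at most (1 + gamma / alpha) / beta times the tolerance passed to [cau]. *)
  have g1 : 0 < 1 + gamma / alpha by rewrite ltr_pwDl // divr_ge0 // ltW.
  have [dl dl0 H] := cau (beta * e / (1 + gamma / alpha)) (divr_gt0 (mulr_gt0 be0 e0) g1).
  exists dl => // h k h0 hd k0 kd; have [H3 H4] := H h k h0 hd k0 kd.
  move: H3; rewrite mulrC -ler_pdivlMr // => H3.
  rewrite -(ler_pM2l be0); apply: (le_trans H4).
  set m := beta * e / _ in H3 *.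
  have -> : beta * e = m + gamma * (m / alpha).
    rewrite /m; field; rewrite !gt_eqF //=.
    by have := g1; rewrite -(pmulr_rgt0 _ a0) mulrDr mulr1 mulrCA divff ?mulr1 // gt_eqF.
  by rewrite lerD2l ler_wpM2l.
exists w', r'; split=> // [v|q].
  apply/eqP; rewrite -subr_eq0 -normr_le0; apply/ler_addgt0Pr => e e0; rewrite add0r.
  pose N := gamma * `|v| + delta * `|v| + `|v| + CC * `|v| + 1.
  have N0 : 0 < N by rewrite ltr_wpDl // !addr_ge0 // mulr_ge0.
  have e1 : 0 < e / N by rewrite divr_gt0.
  have [d2 d20 H2] := FF' _ e1; have [d3 d30 H3] := ww' _ e1.
  have [d4 d40 H4] := rr' _ e1.
  pose h := Order.min (Order.min (Order.min d0 d1) (Order.min d2 d3))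
     (Order.min d4 (e / N)) / 2.
  have h0 : 0 < h by rewrite divr_gt0 // !lt_min d00 d10 d20 d30 d40.
  have : `|h| < Order.min (Order.min (Order.min d0 d1) (Order.min d2 d3))
     (Order.min d4 (e / N)).
    by rewrite gtr0_norm // {1}/h; move: h0; rewrite /h; lra.
  rewrite !lt_min => /and3P[/andP[/andP[h1 h2] /andP[h3 h4]] h5 h6].
  have hn : h != 0 by rewrite gt_eqF.
  have {}H2 := H2 h hn h3 v; have {}H3 := H3 h hn h4; have {}H4 := H4 h hn h5.
  rewrite -/(Dw h) -/(Dr h) in H3 H4; rewrite -/(dF h v) in H2.
  have -> : A w' v + b v r' - (F' v - B (w x) v) =
      - A (Dw h - w') v - b v (Dr h - r') + (dF h v - F' v) - h * B (Dw h) v.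
    by rewrite linearBl linearBr; have := eqD h v hn h1; lra.
  have -> : e = gamma * (e / N) * `|v| + delta * `|v| * (e / N) + e / N * `|v|
       + e / N * (CC * `|v|) + e / N.
    by rewrite /N; field; rewrite gt_eqF.
  have t1 : `|A (Dw h - w') v| <= gamma * (e / N) * `|v|.
    by apply: (le_trans (Acn _ _)); rewrite ler_wpM2r // ler_wpM2l.
  have t2 : `|b v (Dr h - r')| <= delta * `|v| * (e / N).
    by apply: (le_trans (bcn _ _)); rewrite ler_wpM2l // mulr_ge0.
  have t3 : `|h * B (Dw h) v| <= e / N * (CC * `|v|).
    rewrite normrM; apply: ler_pM => //; first exact: ltW.
    apply: (le_trans (Bcn _ _)); rewrite /CC ler_wpM2r // ler_wpM2l //.
    exact: DwM.
  apply: (le_trans (ler_normB _ _)); apply: (le_trans (lerD (ler_normD _ _) (lexx _))).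
  apply: (le_trans (lerD (lerD (ler_normB _ _) (lexx _)) (lexx _))).
  by rewrite normrN; lra.
apply/eqP; rewrite -normr_le0; apply/ler_addgt0Pr => e e0; rewrite add0r.
pose N := delta * `|q| + 1.
have N0 : 0 < N by rewrite ltr_wpDl // mulr_ge0.
have [d1' d10' H] := ww' (e / N) (divr_gt0 e0 N0).
pose h := Order.min d0 d1' / 2.
have h0 : 0 < h by rewrite divr_gt0 // !lt_min d00.
have : `|h| < Order.min d0 d1' by rewrite gtr0_norm // {1}/h; move: h0; rewrite /h; lra.
rewrite lt_min => /andP[h1 h2]; have hn : h != 0 by rewrite gt_eqF.
have -> : b w' q = - b (Dw h - w') q by rewrite linearBl kDw // sub0r opprK.
rewrite normrN; apply: (le_trans (bcn _ _)).
apply: (@le_trans _ _ (delta * (e / N) * `|q|)); first by rewrite ler_wpM2r // ler_wpM2l // H.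
have -> : delta * (e / N) * `|q| = e / N * (delta * `|q|) by ring.
have {2}-> : e = e / N * N by field; rewrite gt_eqF.
by rewrite ler_wpM2l ?divr_ge0 ?ltW // /N ltrDl.
Qed.

Lemma has_deriv_unif (R : realType) (H : normedModType R) (I : eqType) (s : seq I)
    (f : I -> R -> H) (a : R) (l : I -> H) :
  (forall i, i \in s -> has_deriv (f i) a (l i)) ->
  forall e : R, 0 < e -> exists2 dl : R, 0 < dl & forall h : R, h != 0 -> `|h| < dl ->
    forall i, i \in s -> `|h^-1 *: (f i (h + a) - f i a) - l i| <= e.
Proof.
move=> fl e e0; elim: s fl => [|i s IH] fl; first by exists 1.
have [|d1 d10 H1] := IH; first by move=> k ks; apply: fl; rewrite inE ks orbT.
have [|d2 d20 H2] := fl i _ e e0; first by rewrite inE eqxx.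
exists (Order.min d1 d2) => [|h h0]; first by rewrite lt_min d10.
rewrite lt_min => /andP[h1 h2] k; rewrite inE => /orP[/eqP -> |]; first exact: H2.
exact: H1.
Qed.

(** * Iterated partial derivatives indexed by words *)

Section WordDerivatives.
Context {R : realType} {V Q : completeNormedModType R}.
Context (A : (nat -> R) -> {bilinear V -> V -> R | *%R & *%R}).
Context (B : nat -> {bilinear V -> V -> R | *%R & *%R}).
Context (b : {bilinear V -> Q -> R | *%R & *%R}).
Context (f : V -> R) (g : Q -> R) (u : (nat -> R) -> V) (p : (nat -> R) -> Q).
Context (alpha gamma beta delta C : R).
Hypotheses (a0 : 0 < alpha) (g0 : 0 <= gamma) (be0 : 0 < beta).
Hypotheses (d0 : 0 <= delta) (C0 : 0 <= C).

(** Here each coordinate can move in both directions, as two-sided derivatives require; solutions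
    are only given on the closed box. *)
Definition open_box : set (nat -> R) := [set y | forall j, `|y j| < 1].

Hypothesis hA : forall y, open_box y ->
  continuous_form (A y) gamma /\ coercive_on (kernel_space b) (A y) alpha.
Hypotheses (hB : forall j, continuous_form (B j) C) (hb : continuous_form b delta).
Hypothesis hinf : inf_sup_condition b beta.
Hypothesis hAB : forall y j t, open_box y -> open_box [eta y with j |-> t] ->
  forall w v, A [eta y with j |-> t] w v = A y w v + (t - y j) * B j w v.
Hypothesis hup : forall y, open_box y -> saddle_point_solution (A y) b f g (u y) (p y).

Definition word_partial (H : normedModType R) (psi : (nat -> R) -> H) (l : seq nat) :=
  foldr partial psi l.

Local Notation Du := (word_partial u).
Local Notation Dp := (word_partial p).

(** The product rule for an affine form: each letter x of the word, counted with multiplicity, is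
    spent once on the form, which leaves [B x] and the remaining word. *)
Let eqs l := forall y, open_box y ->
  (forall v, A y (Du l y) v + b v (Dp l y) =
     (if l is [::] then f v else 0) - \sum_(x <- l) B x (Du (rem x l) y) v) /\
  (forall q, b (Du l y) q = if l is [::] then g q else 0).

Let der l := forall j y, open_box y ->
  [/\ has_deriv (fun t => Du l [eta y with j |-> t]) (y j) (Du (j :: l) y),
      has_deriv (fun t => Dp l [eta y with j |-> t]) (y j) (Dp (j :: l) y),
      forall v, A y (Du (j :: l) y) v + b v (Dp (j :: l) y) =
        - (\sum_(x <- l) B x (Du (j :: rem x l) y) v) - B j (Du l y) v &
      forall q, b (Du (j :: l) y) q = 0].

Let saddle_unique y (x1 x2 : V) (z1 z2 : Q) : open_box y ->
  (forall v, A y x1 v + b v z1 = A y x2 v + b v z2) ->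
  (forall q, b x1 q = b x2 q) -> x1 = x2 /\ z1 = z2.
Proof.
move=> yo e1 e2; have [Ac Aco] := hA yo.
have [|v|v|h1 h2] := @saddle_stability _ _ _ b (A y) alpha gamma beta 0 (x1 - x2) (z1 - z2)
  (fun=> 0) a0 g0 (lexx _) hinf (continuous_form_norm Ac) Aco.
- by move=> q; rewrite linearBl e2 subrr.
- by rewrite linearBl linearBr /=; have := e1 v; lra.
- by rewrite normr0 mul0r.
have x12 : x1 - x2 = 0 by apply/eqP; rewrite -normr_le0 -(ler_pM2l a0) mulr0.
have z12 : z1 - z2 = 0.
  apply/eqP; rewrite -normr_le0 -(ler_pM2l be0) mulr0.
  by move: h2; rewrite x12 normr0 mulr0 addr0.
by split; apply/eqP; rewrite -subr_eq0 ?x12 ?z12.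
Qed.

(* The right-hand side of the equations for a word only depends on the word up
   to permutation, so unique solvability makes the partial derivatives commute. *)
Let eqs_perm n : (forall l, (size l <= n)%N -> eqs l) ->
  forall l l', (size l <= n)%N -> perm_eq l l' ->
  forall y, open_box y -> Du l y = Du l' y /\ Dp l y = Dp l' y.
Proof.
elim: n => [|n IH] He l l' sl ll' y yo.
  by move: sl ll'; rewrite leqn0 size_eq0 => /eqP ->; rewrite perm_sym => /perm_nilP ->.
have [e1 e2] := He l sl y yo.
have sl' : (size l' <= n.+1)%N by rewrite -(perm_size ll').
have [e1' e2'] := He l' sl' y yo.
have isnil T (c1 c2 : T) : (if l is [::] then c1 else c2) = if l' is [::] then c1 else c2.
  by have := perm_size ll'; case: (l) (l') => [|? ?] [|? ?].
apply: (saddle_unique yo) => [v|q]; last by rewrite e2 e2' isnil.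
rewrite e1 e1' isnil; congr (_ - _).
rewrite [LHS](eq_big_seq (fun x => B x (Du (rem x l') y) v)) ?(perm_big _ ll') //.
move=> x xl; congr (B x _ v).
have xl' : x \in l' by rewrite -(perm_mem ll').
have [] := IH (fun l sl => He l (leqW sl)) (rem x l) (rem x l') _ _ y yo => //.
  by rewrite size_rem //; case: (l) sl xl.
by rewrite -(perm_cons x) -(permPl (perm_to_rem xl)) -(permPr (perm_to_rem xl')).
Qed.

Let with_id (y : nat -> R) j : ([eta y with j |-> y j] : nat -> R) = y.
Proof. by apply/funext => k /=; case: eqP => [->|]. Qed.

Let open_box_with y j (t : R) : open_box y -> `|t| < 1 -> open_box [eta y with j |-> t].
Proof. by move=> yo t1 k /=; case: eqP. Qed.

(** Induction on the length: the right-hand side for l only involves the shorter words [rem x l],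
    already differentiable in direction j, so [saddle_deriv] applies. *)
Let eqs_der n : (forall l, (size l <= n)%N -> eqs l) ->
  forall l, (size l <= n)%N -> der l.
Proof.
move=> He l; have [k] := ubnP (size l); elim: k l => // k IH l sk sl j y yo.
have derl x : x \in l -> der (rem x l).
  move=> xl; have e : (size (rem x l) < size l)%N.
    by rewrite size_rem //; case: (l) xl.
  by apply: IH; [exact: leq_trans e _|exact: leq_trans (ltnW e) _].
pose wt (t : R) : nat -> R := [eta y with j |-> t].
pose dl := 1 - `|y j|.
have dl0 : 0 < dl by rewrite subr_gt0.
have wto h : `|h| < dl -> open_box (wt (h + y j)).
  move=> hd; apply: open_box_with => //; apply: le_lt_trans (ler_normD _ _) _.
  by move: hd; rewrite /dl; lra.
pose F t v := (if l is [::] then f v else 0) - \sum_(x <- l) B x (Du (rem x l) (wt t)) v.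
pose F' v := - \sum_(x <- l) B x (Du (j :: rem x l) y) v.
pose M := \sum_(x <- l) C * `|Du (j :: rem x l) y|.
have wty : wt (y j) = y by exact: with_id.
have Ah h w v : `|h| < dl -> A (wt (h + y j)) w v = A y w v + h * B j w v.
  by move=> hd; rewrite (hAB yo (wto h hd)) addrK.
have M0 : 0 <= M by rewrite /M sumr_ge0 // => x _; rewrite mulr_ge0.
have [|||v|e e0|w' [r' [ww' rr' e1 e2]]] := @saddle_deriv R V Q (A y) (B j) b alpha gamma beta C delta
   M dl (y j) (fun t => Du l (wt t)) (fun t => Dp l (wt t)) F F'
   (fun q => if l is [::] then g q else 0)
  a0 g0 be0 C0 M0 d0 dl0 hinf hb (hB j).
- move=> h hd; have [c1 c2] := hA (wto h hd); split=> [w v|v kv].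
    by rewrite -Ah //; exact: c1.
  by rewrite -Ah //; exact: c2.
- by move=> h hd v; rewrite -Ah // (He l sl _ (wto h hd)).1.
- by move=> h hd q; rewrite (He l sl _ (wto h hd)).2.
- rewrite /F' normrN; apply: (le_trans (ler_norm_sum _ _ _)).
  rewrite /M mulr_suml; apply: ler_sum => x _.
  exact: continuous_form_norm.
- have N0 : 0 < \sum_(x <- l) C + 1 by rewrite ltr_wpDl // sumr_ge0.
  have [|d1 d10 H1] := @has_deriv_unif R V nat l
    (fun x t => Du (rem x l) (wt t)) (y j) (fun x => Du (j :: rem x l) y) _
    (e / (\sum_(x <- l) C + 1)) (divr_gt0 e0 N0).
    by move=> x xl; have [] := derl x xl j y yo.
  exists d1 => // h h0 hd v; rewrite /F /F' wty.
  have -> : h^-1 * ((if l is [::] then f v else 0) -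
      \sum_(x <- l) B x (Du (rem x l) (wt (h + y j))) v -
      ((if l is [::] then f v else 0) - \sum_(x <- l) B x (Du (rem x l) y) v)) -
      - (\sum_(x <- l) B x (Du (j :: rem x l) y) v) =
      - \sum_(x <- l) B x (h^-1 *: (Du (rem x l) (wt (h + y j)) - Du (rem x l) y)
           - Du (j :: rem x l) y) v.
    under [in RHS]eq_bigr do rewrite linearBl linearZl_LR linearBl.
    rewrite sumrB -mulr_sumr sumrB; ring.
  rewrite normrN; apply: (le_trans (ler_norm_sum _ _ _)).
  apply: (@le_trans _ _ (\sum_(x <- l) C * (e / (\sum_(x <- l) C + 1)) * `|v|)).
    rewrite big_seq [leRHS]big_seq; apply: ler_sum => x xl.
    apply: (le_trans (continuous_form_norm (hB x) _ _)).
    rewrite ler_wpM2r // ler_wpM2l //.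
    by have := H1 h h0 hd x xl; rewrite wty.
  rewrite -!mulr_suml ler_wpM2r // mulrA ler_pdivrMr // mulrC ler_wpM2l ?(ltW e0) //.
  by rewrite lerDl.
have wE : Du (j :: l) y = w' by exact: has_deriv1.
have rE : Dp (j :: l) y = r' by exact: has_deriv1.
by rewrite /= in wE rE; split; rewrite /= ?wE ?rE // => v; rewrite e1 wty.
Qed.

(** The equations for j :: l come from differentiating those for l. For a letter x = j of l,
    differentiation produces the word [j :: rem j l] where l is wanted; this only needs commutation
    for words no longer than l, where the equations are already known. *)
Let word_eqs l : eqs l.
Proof.
have [n] := ubnP (size l); elim: n l => // n IH [|j l] sl.
  by move=> y yo; have [e1 e2] := hup yo; split=> [v|q] //=; rewrite big_nil subr0.
have He k : (size k <= size l)%N -> eqs k.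
  by move=> kl; apply: IH; exact: leq_ltn_trans kl _.
move=> y yo; have [_ _ e1 e2] := eqs_der He (leqnn _) j yo.
split=> [v|q]; last exact: e2.
rewrite e1 big_cons /= eqxx sub0r opprD addrC; congr (_ - _).
apply: eq_big_seq => x xl; case: eqVneq => // e; rewrite -e in xl *.
have sj : (size (j :: rem j l) <= size l)%N by rewrite /= size_rem //; case: (l) xl.
have pj : perm_eq (j :: rem j l) l by rewrite perm_sym perm_to_rem.
by rewrite -(eqs_perm He sj pj yo).1.
Qed.

Let word_perm l l' : perm_eq l l' ->
  forall y, open_box y -> Du l y = Du l' y /\ Dp l y = Dp l' y.
Proof. by apply: (@eqs_perm (size l)). Qed.

Implicit Types (nu : multi_index).

Definition mi_word (nu : multi_index) : seq nat :=
  flatten [seq nseq (nu j) j | j <- finsupp nu].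

Lemma mixed_partialE (H : normedModType R) (psi : (nat -> R) -> H) nu :
  mixed_partial nu psi = word_partial psi (mi_word nu).
Proof.
rewrite /mixed_partial /word_partial /mi_word.
elim: (enum_fset _) => //= j s ->; rewrite foldr_cat.
by elim: (nu j) => //= k ->.
Qed.

Lemma sum_mi_word (U : nmodType) (G : nat -> U) nu n :
  (forall j, (n <= j)%N -> nu j = 0%N) ->
  \sum_(x <- mi_word nu) G x = \sum_(j < n) G j *+ nu j.
Proof.
move=> nun; rewrite -(@big_finsupp _ _ _ (fun j k => G j *+ k)) //.
rewrite /mi_word big_flatten big_map; apply: eq_bigr => j _.
by rewrite big_nseq iter_addr_0.
Qed.

Lemma count_mi_word nu k : count_mem k (mi_word nu) = nu k.
Proof.
have [n /mi_boxP[_ nun]] := in_mi_box nu.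
rewrite /mi_word count_flatten sumnE !big_map.
under eq_bigr do rewrite count_nseq /=.
rewrite (@big_finsupp _ _ _ (fun j m => ((j == k) * m)%N) _ n) // => [|j]; last by rewrite muln0.
have [nk|kn] := leqP n k.
  rewrite nun // big1 // => j _.
  by case: eqP (ltn_ord j) => // ->; rewrite ltnNge nk.
rewrite (bigD1 (Ordinal kn)) //= eqxx mul1n big1 ?addn0 // => j jk.
by case: eqP => // e; move: jk; rewrite -(inj_eq val_inj) /= e eqxx.
Qed.

Let perm_word_pred nu j : perm_eq (rem j (mi_word nu)) (mi_word (mi_pred nu j)).
Proof.
apply/allP => k _ /=.
rewrite count_rem !count_mi_word mi_predE /= -has_pred1 has_count count_mi_word.
by apply/eqP; case: (eqVneq j k) => [<-|_]; [case: (nu j)|rewrite andbF].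
Qed.

Lemma mi_fact_pred nu j : (0 < nu j)%N -> mi_fact nu = (nu j * mi_fact (mi_pred nu j))%N.
Proof.
move=> nuj; have [n nub] := in_mi_box nu; have /mi_boxP[_ nun] := nub.
have /mi_boxP[_ pn] := mi_pred_box j nub.
have jn : (j < n)%N by rewrite ltnNge; apply: contraTN nuj => /nun ->.
rewrite /mi_fact !(@big_finsupp _ _ _ (fun _ k => k`!) _ n) //.
rewrite [LHS](bigD1 (Ordinal jn)) //= [in RHS](bigD1 (Ordinal jn)) //= mulnA; congr (_ * _)%N.
  by rewrite mi_predE eqxx subn1; case: (nu j) nuj => // k _; rewrite factS.
by apply: eq_bigr => i ij; rewrite mi_predE (negbTE (_ : j != i)) ?subn0 // eq_sym.
Qed.

Lemma open_box0 : open_box (fun=> 0).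
Proof. by move=> j; rewrite normr0. Qed.

Lemma taylor_coef0 :
  saddle_point_solution (A (fun=> 0)) b f g (taylor_coef u mi0) (taylor_coef p mi0).
Proof.
have [e1 e2] := hup open_box0.
rewrite /taylor_coef /mi_fact /mixed_partial finsupp0 big_seq_fset0 invr1 !scale1r.
by split.
Qed.

(** The letter j occurs nu_j times in the word of nu, and this factor turns 1 / nu! into 1 / (nu -
    e_j)!. *)
Lemma taylor_coef_rec n nu : nu \in mi_box n -> nu != mi0 ->
  (forall v, A (fun=> 0) (taylor_coef u nu) v + b v (taylor_coef p nu) =
    - \sum_(j < n | (0 < nu j)%N) B j (taylor_coef u (mi_pred nu j)) v) /\
  (forall q, b (taylor_coef u nu) q = 0).
Proof.
move=> /mi_boxP[_ nun] /mi_neq0[k nuk]; have [e1 e2] := word_eqs (mi_word nu) open_box0.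
have nnil T (c1 c2 : T) : (if mi_word nu is [::] then c1 else c2) = c2.
  by have := count_mi_word nu k; case: (mi_word nu) => //= e; rewrite -e in nuk.
rewrite /taylor_coef !mixed_partialE; split=> [v|q]; last first.
  by rewrite linearZl_LR e2 nnil mulr0.
rewrite linearZl_LR linearZr_LR /= -mulrDr e1 nnil sub0r mulrN; congr (- _).
rewrite (sum_mi_word _ nun) mulr_sumr [RHS]big_mkcond; apply: eq_bigr => j _.
case: ltnP => [nuj|]; last by rewrite leqn0 => /eqP ->; rewrite mulr0n mulr0.
rewrite mixed_partialE; have [-> _] := word_perm (perm_word_pred nu j) open_box0.
rewrite linearZl_LR /= -[B _ _ _ *+ _]mulr_natl (mi_fact_pred nuj) natrM invfM.
by rewrite mulrACA mulVf ?mul1r // pnatr_eq0 -lt0n.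
Qed.

End WordDerivatives.

(** * Weighted energy estimates for the Taylor coefficients *)

(** The choice c^2 = N / x gives x <= (N Y / x + x) / 2. Unlike the minimizer in c, it remains
    available for Y = 0. *)
Lemma le_sq_of_young (R : realType) (x Y N : R) : 0 <= x -> 0 < N -> 0 <= Y ->
  (forall c : R, 0 < c -> x <= (c ^+ 2 * Y + (c ^+ 2)^-1 * N) / 2) -> x ^+ 2 <= N * Y.
Proof.
move=> x0 N0 Y0 H; have [->|xn0] := eqVneq x 0.
  by rewrite expr0n /= mulr_ge0 ?(ltW N0).
have {xn0 x0} x0 : 0 < x by rewrite lt_neqAle eq_sym xn0.
have Nx : 0 < N / x by rewrite divr_gt0.
have := H (Num.sqrt (N / x)); rewrite sqrtr_gt0 sqr_sqrtr ?(ltW Nx) // => /(_ Nx).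
rewrite invf_div divfK ?gt_eqF // => h.
have : x <= N / x * Y by lra.
by rewrite mulrAC ler_pdivlMr.
Qed.

Section Energy.
Context {R : realType} {V Q : normedModType R}.
Context (A0 : {bilinear V -> V -> R | *%R & *%R}).
Context (B Bab : nat -> {bilinear V -> V -> R | *%R & *%R}).
Context (b : {bilinear V -> Q -> R | *%R & *%R}).
Context (T : multi_index -> V) (P : multi_index -> Q).
Context (alpha gamma beta M : R) (rho : nat -> R).
Hypotheses (al0 : 0 < alpha) (ga0 : 0 <= gamma) (be0 : 0 < beta) (M0 : 0 <= M).
Hypotheses (hA : continuous_form A0 gamma) (hinf : inf_sup_condition b beta).
Hypothesis hBab : forall j w v, B j w v <= 2^-1 * (Bab j w w + Bab j v v).
Hypothesis hrec : forall n (nu : multi_index), nu \in mi_box n -> nu != mi0 ->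
  (forall v, A0 (T nu) v + b v (P nu) =
    - \sum_(j < n | (0 < nu j)%N) B j (T (mi_pred nu j)) v) /\
  (forall q, b (T nu) q = 0).
Hypothesis rho0 : forall j, 0 <= rho j.
Hypothesis hco : forall n v, kernel_space b v ->
  alpha * `|v| ^+ 2 + \sum_(j < n) rho j * Bab j v v <= A0 v v.
Hypothesis hM : forall n v, \sum_(j < n) rho j * Bab j v v <= M * `|v| ^+ 2.

Implicit Types (nu mu : multi_index).

Let s nu := mi_pow rho nu *: T nu.
Let r nu := mi_pow rho nu *: P nu.
Let e n nu := \sum_(j < n) rho j * Bab j (s nu) (s nu).
Let S n nu := \sum_(j < n | (0 < nu j)%N) rho j * Bab j (s (mi_pred nu j)) (s (mi_pred nu j)).

Let Bab_ge0 j v : 0 <= Bab j v v.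
Proof. by have := hBab j 0 v; rewrite !linear0l add0r pmulr_rge0 ?invr_gt0. Qed.

Let BabN j x : Bab j (- x) (- x) = Bab j x x.
Proof. by rewrite linearNl linearNr opprK. Qed.

(** Scaling the arguments by c and 1 / c leaves B unchanged; with c free, the bound by an arithmetic
    mean becomes as strong as a Cauchy-Schwarz inequality. *)
Let Bscale j w z (c : R) : 0 < c ->
  B j w z <= (c ^+ 2 * Bab j w w + (c ^+ 2)^-1 * Bab j z z) / 2.
Proof.
move=> c0; have -> : B j w z = B j (c *: w) (c^-1 *: z).
  by rewrite linearZl_LR linearZr_LR /= mulrA divff ?mul1r ?gt_eqF.
have BZ x (t : R) : Bab j (t *: x) (t *: x) = t * (t * Bab j x x).
  by rewrite linearZl_LR linearZr_LR.
apply: (le_trans (hBab _ _ _)); rewrite !BZ le_eqVlt; apply/predU1P; left.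
by field; rewrite gt_eqF.
Qed.

Let rBab_ge0 j v : 0 <= rho j * Bab j v v.
Proof. by rewrite mulr_ge0. Qed.

Let e_ge0 n nu : 0 <= e n nu.
Proof. exact: sumr_ge0. Qed.

Let S_ge0 n nu : 0 <= S n nu.
Proof. exact: sumr_ge0. Qed.

(** The minus sign is moved into the argument because the bound on B is one-sided, whereas [Bab] is
    even. The factor rho_j comes from rho^nu = rho_j rho^(nu - e_j). *)
Let srec n nu : nu \in mi_box n -> nu != mi0 ->
  (forall v, A0 (s nu) v + b v (r nu) =
    \sum_(j < n | (0 < nu j)%N) rho j * B j (- s (mi_pred nu j)) v) /\
  (forall q, b (s nu) q = 0).
Proof.
move=> nub nu0; have [e1 e2] := hrec nub nu0; split=> [v|q]; last first.
  by rewrite linearZl_LR e2 mulr0.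
rewrite linearZl_LR linearZr_LR /= -mulrDr e1 -sumrN mulr_sumr; apply: eq_bigr => j nuj.
by rewrite linearNl linearZl_LR (mi_pow_pred _ nuj) /=; ring.
Qed.

(** The chain is alpha |s|^2 + e <= A0(s, s) <= (S + e) / 2, and half of e is absorbed on the
    left. *)
Let energy n nu : nu \in mi_box n -> nu != mi0 ->
  2 * alpha * `|s nu| ^+ 2 + e n nu <= S n nu.
Proof.
move=> nub nu0; have [e1 e2] := srec nub nu0.
have := hco n e2; rewrite -/(e n nu).
have := e1 (s nu); rewrite e2 addr0 => ->.
suff : \sum_(j < n | (0 < nu j)%N) rho j * B j (- s (mi_pred nu j)) (s nu) <=
    2^-1 * (S n nu + e n nu) by lra.
apply: (@le_trans _ _ (2^-1 * \sum_(j < n | (0 < nu j)%N)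
   (rho j * Bab j (s (mi_pred nu j)) (s (mi_pred nu j)) + rho j * Bab j (s nu) (s nu)))).
  rewrite mulr_sumr; apply: ler_sum => j nuj.
  rewrite -mulrDr mulrCA ler_wpM2l //; apply: (le_trans (hBab _ _ _)).
  by rewrite BabN.
rewrite big_split /= ler_pM2l ?invr_gt0 // lerD2l /e big_mkcond.
by apply: ler_sum => j _; case: ifP.
Qed.

Let mi0_split (F : multi_index -> R) n :
  \sum_(nu <- mi_box n) F nu = F mi0 + \sum_(nu <- mi_box n | nu != mi0) F nu.
Proof. by rewrite (big_rem _ (mi0_box n)) rem_filter ?fset_uniq ?big_filter. Qed.

Let sum_S n : \sum_(nu <- mi_box n | nu != mi0) S n nu <= \sum_(nu <- mi_box n) e n nu.
Proof.
have := @sum_mi_pred_le _ (fun mu j => rho j * Bab j (s mu) (s mu)) n _.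
rewrite -/(S n _) => /(_ (fun mu j => rBab_ge0 j _)); apply: le_trans.
by rewrite (mi0_split (S n)) lerDr.
Qed.

(** When [energy] is summed over the nonzero indices, the sums of e cancel by [sum_S]; what bounds 2
    alpha sum |s|^2 is e(0) <= M |T_0|^2. *)
Lemma energy_u n :
  \sum_(nu <- mi_box n) (mi_pow rho nu * `|T nu|) ^+ 2 <=
  `|T mi0| ^+ 2 * (1 + M / (2 * alpha)).
Proof.
have sE nu : mi_pow rho nu * `|T nu| = `|s nu|.
  by rewrite normrZ ger0_norm // mi_pow_ge0.
under eq_bigr do rewrite sE.
have s0 : s mi0 = T mi0 by rewrite /s mi_pow0 scale1r.
rewrite mi0_split s0 mulrDr mulr1 lerD2l mulrA ler_pdivlMr ?mulr_gt0 //.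
have e0 : e n mi0 <= M * `|T mi0| ^+ 2 by rewrite -s0; exact: hM.
rewrite [leRHS]mulrC; apply: le_trans e0.
have := sum_S n; rewrite (mi0_split (e n)) => h.
have : \sum_(nu <- mi_box n | nu != mi0) (2 * alpha * `|s nu| ^+ 2 + e n nu) <=
   \sum_(nu <- mi_box n | nu != mi0) S n nu.
  rewrite big_seq_cond [leRHS]big_seq_cond; apply: ler_sum => nu /andP[nub nu0].
  exact: energy.
by rewrite big_split /= -mulr_sumr mulrC; lra.
Qed.

(** For a unit vector z, Young's inequality with a free parameter c bounds b z (r nu) by half of c^2
    (S + gamma^2 |s|^2) + c^-2 (M + 1), whence (beta |r|)^2 <= (M + 1) (S + gamma^2 |s|^2). In the
    sum over nu, S contributes at most M sum |s|^2, and [energy_u] applies. *)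
Lemma energy_p n :
  \sum_(nu <- mi_box n) (mi_pow rho nu * `|P nu|) ^+ 2 <=
  `|P mi0| ^+ 2 +
  (M + 1) * (M + gamma ^+ 2) / beta ^+ 2 * (`|T mi0| ^+ 2 * (1 + M / (2 * alpha))).
Proof.
have rE nu : mi_pow rho nu * `|P nu| = `|r nu|.
  by rewrite normrZ ger0_norm // mi_pow_ge0.
under eq_bigr do rewrite rE.
have r0 : r mi0 = P mi0 by rewrite /r mi_pow0 scale1r.
rewrite mi0_split r0 lerD2l mulrAC ler_pdivlMr ?exprn_gt0 //.
apply: (@le_trans _ _ ((M + 1) * (M + gamma ^+ 2) * \sum_(nu <- mi_box n) `|s nu| ^+ 2)); last first.
  rewrite ler_wpM2l ?mulr_ge0 ?addr_ge0 ?exprn_ge0 //; apply: le_trans (energy_u n).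
  by apply: ler_sum => nu _; rewrite /s normrZ ger0_norm // mi_pow_ge0.
have pt nu : nu \in mi_box n -> nu != mi0 ->
    (beta * `|r nu|) ^+ 2 <= (M + 1) * (S n nu + gamma ^+ 2 * `|s nu| ^+ 2).
  move=> nub nu0; have [e1 _] := srec nub nu0.
  apply: le_sq_of_young.
  - by rewrite mulr_ge0 // ltW.
  - by rewrite ltr_wpDl.
  - by rewrite addr_ge0 // mulr_ge0 // exprn_ge0.
  move=> c c0; have ci0 : 0 < c^-1 by rewrite invr_gt0.
  have c2 : 0 < (c ^+ 2)^-1 by rewrite invr_gt0 exprn_gt0.
  apply: (inf_sup_bound hinf) => [|v].
    by rewrite divr_ge0 // addr_ge0 // !mulr_ge0 ?addr_ge0 ?mulr_ge0 ?sqr_ge0 // ltW.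
  have [->|v0] := eqVneq v 0; first by rewrite linear0l normr0 mulr0.
  have nv : 0 < `|v| by rewrite normr_gt0.
  pose z := `|v|^-1 *: v.
  have nz : `|z| = 1 by rewrite normrZ ger0_norm ?invr_ge0 // mulVf ?gt_eqF.
  have vE : v = `|v| *: z by rewrite /z scalerA divff ?gt_eqF // scale1r.
  rewrite {1}vE linearZl_LR mulrC /= ler_pM2r //.
  have -> : b z (r nu) = \sum_(j < n | (0 < nu j)%N) rho j * B j (- s (mi_pred nu j)) z - A0 (s nu) z.
    by rewrite -e1; ring.
  have t1 : - A0 (s nu) z <= (c ^+ 2 * (gamma ^+ 2 * `|s nu| ^+ 2) + (c ^+ 2)^-1) / 2.
    have := hA (- s nu) z; rewrite linearNl normrN nz mulr1 => h; apply: (le_trans h).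
    have : 0 <= (c * (gamma * `|s nu|) - c^-1) ^+ 2 by exact: sqr_ge0.
    rewrite sqrrB -exprVn -!exprMn.
    have -> : c * (gamma * `|s nu|) / c = gamma * `|s nu| by field; rewrite gt_eqF.
    by rewrite mulr2n; lra.
  have t2 : \sum_(j < n | (0 < nu j)%N) rho j * B j (- s (mi_pred nu j)) z <=
      (c ^+ 2 * S n nu + (c ^+ 2)^-1 * M) / 2.
    apply: (@le_trans _ _ (2^-1 * \sum_(j < n | (0 < nu j)%N)
      (c ^+ 2 * (rho j * Bab j (s (mi_pred nu j)) (s (mi_pred nu j))) +
       (c ^+ 2)^-1 * (rho j * Bab j z z)))).
      rewrite mulr_sumr; apply: ler_sum => j nuj.
      apply: (le_trans (ler_wpM2l (rho0 j) (Bscale _ _ _ c0))); rewrite le_eqVlt; apply/predU1P; left.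
      by rewrite BabN; ring.
    rewrite big_split /= -!mulr_sumr mulrC ler_pM2r ?invr_gt0 // lerD2l ler_pM2l //.
    apply: (@le_trans _ _ (\sum_(j < n) rho j * Bab j z z)).
      by rewrite big_mkcond; apply: ler_sum => j _; case: ifP.
    by apply: le_trans (hM n z) _; rewrite nz expr1n mulr1.
  by lra.
rewrite mulr_suml.
apply: (@le_trans _ _ (\sum_(nu <- mi_box n | nu != mi0) (M + 1) * (S n nu + gamma ^+ 2 * `|s nu| ^+ 2))).
  rewrite big_seq_cond [leRHS]big_seq_cond; apply: ler_sum => nu /andP[nub nu0].
  by rewrite mulrC -exprMn; exact: pt.
rewrite -mulr_sumr -mulrA ler_wpM2l ?addr_ge0 // big_split /= mulrDl lerD //.
  apply: (le_trans (sum_S n)); rewrite mulr_sumr; apply: ler_sum => nu _; exact: hM.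
by rewrite -mulr_sumr ler_wpM2l ?exprn_ge0 // (mi0_split (fun nu => `|s nu| ^+ 2)) lerDr exprn_ge0.
Qed.

End Energy.

(** * Largest index sets and Stechkin's inequality *)

Section LargestIndexSets.
Context {R : realType}.
Implicit Types (nu mu : multi_index) (theta : multi_index -> R).

Lemma le_envelope theta nu : ((theta nu)%:E <= envelope theta nu)%E.
Proof. by apply: ereal_sup_ubound; exists nu => // j. Qed.

Lemma envelope_le theta nu (c : R) : (forall mu, mi_le nu mu -> theta mu <= c) ->
  (envelope theta nu <= c%:E)%E.
Proof. by move=> h; apply: ge_ereal_sup => _ [mu /= numu <-]; rewrite lee_fin h. Qed.

Lemma envelope_anti theta nu mu : mi_le mu nu ->
  (envelope theta nu <= envelope theta mu)%E.
Proof.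
move=> munu; apply: ge_ereal_sup => _ [x /= nux <-]; apply: ereal_sup_ubound.
by exists x => // j; exact: leq_trans (munu j) (nux j).
Qed.

Lemma envelope_ge0 theta nu : (forall mu, 0 <= theta mu) -> (0 <= envelope theta nu)%E.
Proof. by move=> t0; apply: le_trans (le_envelope theta nu); rewrite lee_fin. Qed.

Lemma sq_sum_decay theta (C : R) :
  (forall n, \sum_(nu <- mi_box n) theta nu ^+ 2 <= C) ->
  forall e : R, 0 < e -> exists n, forall nu, nu \notin mi_box n -> theta nu <= e.
Proof.
move=> hC e e0; pose S n := \sum_(nu <- mi_box n) theta nu ^+ 2.
have hs : has_sup (range S).
  by split; [exists (S 0%N), 0%N|exists C => _ [n _ <-]; exact: hC].
have [_ [n _ <-] Sn] := sup_adherent (exprn_gt0 2 e0) hs.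
exists n => nu nun; have [m num] := in_mi_box nu.
have nm : (n <= maxn n m)%N by exact: leq_maxl.
have Sm : S (maxn n m) <= sup (range S).
  by apply: (ub_le_sup hs.2); exists (maxn n m).
have : S n + theta nu ^+ 2 <= S (maxn n m).
  rewrite /S [leRHS](big_rem nu) /=; last exact: mi_box_le (leq_maxr _ _) _ num.
  rewrite [leLHS]addrC lerD2l rem_filter ?fset_uniq // big_filter.
  rewrite [leRHS](bigID (mem (mi_box n))) /= ler_wpDr ?sumr_ge0 // => [x _|].
    exact: sqr_ge0.
  rewrite le_eqVlt; apply/predU1P; left; rewrite -[RHS]big_filter; apply: perm_big.
  apply: uniq_perm; rewrite ?seq.filter_uniq ?fset_uniq // => x.
  rewrite mem_filter; apply/idP/andP => [xn|[/andP[] //]]; split; last exact: mi_box_le xn.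
  by rewrite xn andbT; apply: contraNneq nun => <-.
move=> h; rewrite leNgt; apply/negP => te.
have : e ^+ 2 < theta nu ^+ 2 by rewrite ltr_pXn2r ?nnegrE ?ltW // (lt_trans e0).
by move: h Sm Sn; lra.
Qed.

Definition mi_deg nu : nat := (\sum_(j <- finsupp nu) nu j)%N.

Lemma mi_deg_le nu mu : mi_le mu nu -> (mi_deg nu <= mi_deg mu)%N -> mu = nu.
Proof.
move=> munu; have [n nub] := in_mi_box nu; have /mi_boxP[_ nun] := nub.
have /mi_boxP[_ mun] := mi_box_down nub munu.
rewrite /mi_deg !(@big_finsupp _ _ _ (fun j k => k) _ n) // => h.
have [_ ] := leqif_sum (fun (i : 'I_n) (_ : true) => leqif_geq (munu i)).
rewrite eqn_leq h leq_sum // => /esym/forallP /= E.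
apply/fsfunP => j; have [nj|jn] := leqP n j; first by rewrite nun ?mun.
by apply/eqP; rewrite eqn_leq munu /= (E (Ordinal jn)).
Qed.

Lemma seq_max d (T : eqType) (U : orderType d) (F : T -> U) (s : seq T) x0 :
  x0 \in s -> exists2 x, x \in s & forall y, y \in s -> (F y <= F x)%O.
Proof.
elim: s x0 => // a s IH _ _; case: s IH => [|a' s] IH.
  by exists a; rewrite ?inE // => y; rewrite inE => /eqP ->.
have [x xs hx] := IH a' (mem_head _ _); have [le|lt] := leP (F x) (F a).
  exists a; rewrite ?mem_head // => y; rewrite inE => /orP[/eqP -> //|/hx h].
  exact: le_trans h le.
exists x; first by rewrite inE xs orbT.
by move=> y; rewrite inE => /orP[/eqP ->|/hx //]; exact: ltW.
Qed.

(** Each step adds an index of maximal envelope outside the current set and, among these, one of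
    minimal total degree. If mu lies below the new index and is still outside, monotonicity makes
    the two envelopes equal, and minimality of the degree makes mu the new index itself; hence
    downward closedness. The maximum is attained since only finitely many envelopes exceed a given
    positive number. *)
Lemma largest_index_sets_ex theta : (forall nu, 0 <= theta nu) ->
  (forall e : R, 0 < e -> exists n, forall nu, nu \notin mi_box n -> theta nu <= e) ->
  exists L, largest_index_sets theta L.
Proof.
move=> t0 dec; pose E := envelope theta.
have outside (s : seq multi_index) : exists nu, nu \notin s.
  have [n sn] := seq_mi_box s; exists (mi_succ mi0 n).
  apply/negP => /sn /mi_boxP[_ /(_ n (leqnn _))].
  by rewrite mi_succE eqxx.
have maxE (s : seq multi_index) : exists nu, nu \notin s /\
    forall mu, mu \notin s -> (E mu <= E nu)%E.
  have [[nu1 [nu1s E1]]|/forallNP no] := pselect (exists nu, nu \notin s /\ (0 < E nu)%E).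
    have [c c0 cE] : exists2 c : R, 0 < c & (c%:E < E nu1)%E.
      (* Any positive real below [E nu1] will do, so an infinite envelope need not be excluded. *)
      move: E1; case: (E nu1) => [r|_|//]; last by exists 1; rewrite ?ltry.
      by rewrite lte_fin => r0; exists (r / 2); rewrite ?lte_fin; lra.
    have [n hn] := dec c c0.
    have out nu : nu \notin mi_box n -> (E nu <= c%:E)%E.
      move=> nun; apply: envelope_le => mu numu; apply: hn.
      by apply: contraNN nun => mun; exact: mi_box_down mun numu.
    have n1 : nu1 \in [seq nu <- mi_box n | nu \notin s].
      by rewrite mem_filter nu1s; apply: contraLR cE => /out; rewrite -leNgt.
    have [nu] := seq_max E n1; rewrite mem_filter => /andP[nus nun] numax.
    exists nu; split=> // mu mus; have [mun|/out muc] := boolP (mu \in mi_box n).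
      by apply: numax; rewrite mem_filter mus.
    exact: le_trans muc (le_trans (ltW cE) (numax _ n1)).
  (* All envelopes outside s vanish here, so any index is maximal. *)
  have [nu nus] := outside s; exists nu; split=> // mu mus.
  have : ~ (0 < E mu)%E by move=> h; exact: (no mu).
  by move/negP; rewrite -leNgt => /le_trans; apply; exact: envelope_ge0.
have next (s : seq multi_index) : exists nu, nu \notin s /\
    forall mu, mu \notin s -> (E mu <= E nu)%E /\
      (E mu = E nu -> (mi_deg nu <= mi_deg mu)%N).
  have [nu0 [nu0s nu0max]] := maxE s.
  pose Pm k := `[< exists nu, [/\ nu \notin s, E nu = E nu0 & mi_deg nu = k] >].
  have exP : exists k, Pm k by exists (mi_deg nu0); apply/asboolP; exists nu0.
  case: (ex_minnP exP) => k /asboolP[nu [nus nuE nuk]] kmin.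
  exists nu; split=> // mu mus; rewrite nuE; split=> [|muE]; first exact: nu0max.
  by rewrite nuk kmin //; apply/asboolP; exists mu.
pose nx (s : seq multi_index) := projT1 (cid (next s)).
have nxP s := projT2 (cid (next s)).
pose L := fix L N : {fset multi_index} := if N is N'.+1 then (nx (L N') |` L N')%fset else fset0.
have LS N : L N.+1 = (nx (L N) |` L N)%fset by [].
have big N nu mu : nu \in L N -> mu \notin L N -> (E mu <= E nu)%E.
  elim: N => [|N IH]; first by rewrite inE.
  rewrite LS !inE negb_or => /orP[/eqP ->|nuL] /andP[_ muL]; last exact: IH.
  by have [_ /(_ mu muL)[]] := nxP (L N).
exists L => N _; split=> //.
- elim: N => [|N IH]; first by rewrite cardfs0.
  by rewrite LS cardfsU1 IH; have [-> _] := nxP (L N).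
- elim: N => [|N IH] nu mu; first by rewrite inE.
  rewrite LS !inE => /orP[/eqP ->|nuL] munu; last by rewrite (IH nu) ?orbT.
  have [muL|muL] := boolP (mu \in L N); first by rewrite orbT.
  have [_ /(_ mu muL)[h1 h2]] := nxP (L N).
  have/h2 : E mu = E (nx (L N)) by apply/eqP; rewrite eq_le h1 envelope_anti.
  by move=> /(mi_deg_le munu) ->; rewrite eqxx.
- by rewrite LS; exact: fsubsetU1.
- exact: big.
Qed.

End LargestIndexSets.

(** * Tails outside the largest index sets *)

Section BestApproximation.
Context {R : realType}.
Implicit Types (nu mu : multi_index) (theta e : multi_index -> R).

Lemma sum_le_fset (F : multi_index -> R) (A B : {fset multi_index}) :
  (forall nu, 0 <= F nu) -> {subset A <= B} ->
  \sum_(nu <- A) F nu <= \sum_(nu <- B) F nu.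
Proof.
move=> F0 AB; rewrite [leRHS](bigID (mem A)) /= ler_wpDr ?sumr_ge0 //.
rewrite le_eqVlt; apply/predU1P; left; rewrite -[RHS]big_filter; apply: perm_big.
apply: uniq_perm; rewrite ?seq.filter_uniq ?fset_uniq // => x.
by rewrite mem_filter; apply/idP/andP => [xA|[] //]; split=> //; exact: AB.
Qed.

Lemma envelope_real theta e (s C : R) : 0 < s ->
  (forall nu, envelope theta nu = (e nu)%:E) -> (forall nu, 0 <= e nu) ->
  (forall n, \sum_(nu <- mi_box n) e nu `^ s <= C) ->
  exists S : R, [/\ lm_norm s theta = (S `^ s^-1)%:E, 0 <= S &
    forall A : {fset multi_index}, \sum_(nu <- A) e nu `^ s <= S].
Proof.
move=> s0 eE e0 hC; pose T := (\esum_(nu in [set: multi_index]) (envelope theta nu `^ s))%E.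
have TE : T = (\esum_(nu in [set: multi_index]) (e nu `^ s)%:E)%E.
  by apply: eq_esum => nu _; rewrite eE poweR_EFin.
have T0 : (0 <= T)%E by rewrite TE; apply: esum_ge0 => nu _; rewrite lee_fin powR_ge0.
have TC : (T <= C%:E)%E.
  rewrite TE; apply: ge_ereal_sup => _ [A [finA _] <-].
  rewrite fsbig_finite //= sumEFin lee_fin.
  have [n An] := seq_mi_box (fset_set A).
  by apply: le_trans (hC n); apply: sum_le_fset => // nu; exact: powR_ge0.
have Tfin : T \is a fin_num by rewrite ge0_fin_numE // (le_lt_trans TC) ?ltry.
exists (fine T); split.
- by rewrite /lm_norm -/T -{1}(fineK Tfin) poweR_EFin.
- exact: fine_ge0.
- move=> A; rewrite -lee_fin fineK // TE; apply: esum_ge; exists [set` A].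
    by split=> //; exact: finite_fset.
  by rewrite fsbig_finite //= set_fsetK sumEFin.
Qed.

(** Outside [L N], e^s is at most each of the N values on [L N], hence at most S / N. Since s (1 +
    rate s) = 1, e = e^s (e^s)^(rate s), and summing the first factor gives S (S / N)^(rate s). *)
Lemma stechkin theta e (s S : R) L N n : 0 < s < 1 -> (1 <= N)%N ->
  (forall nu, envelope theta nu = (e nu)%:E) -> (forall nu, 0 <= e nu) ->
  (forall A : {fset multi_index}, \sum_(nu <- A) e nu `^ s <= S) ->
  largest_index_sets theta L ->
  \sum_(nu <- mi_box n | nu \notin L N) e nu <= S `^ s^-1 * N%:R `^ (- rate s).
Proof.
move=> /andP[s0 s1] N1 eE e0 hS hL; have [cL _ _ big] := hL N N1.
have S0 : 0 <= S by apply: le_trans (hS fset0); rewrite big_seq_fset0.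
have N0 : (0 : R) < N%:R by rewrite ltr0n.
have r0 : 0 < rate s by rewrite /rate subr_gt0 invf_gt1.
have pt nu : nu \notin L N -> e nu <= e nu `^ s * (S / N%:R) `^ rate s.
  move=> nuL; have h : e nu `^ s <= S / N%:R.
    rewrite ler_pdivlMr // mulrC mulr_natl; apply: le_trans (hS (L N)).
    have -> : e nu `^ s *+ N = \sum_(mu <- L N) e nu `^ s.
      by rewrite big_const_seq count_predT iter_addr_0; congr (_ *+ _); rewrite -[LHS]cL.
    rewrite big_seq [leRHS]big_seq; apply: ler_sum => mu muL.
    apply: ge0_ler_powR; rewrite ?nnegrE ?(ltW s0) //.
    by rewrite -lee_fin -!eE; exact: big.
  have [->|en] := eqVneq (e nu) 0; first by rewrite powR0 ?mul0r // gt_eqF.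
  have {1}-> : e nu = e nu `^ s * (e nu `^ s) `^ rate s.
    rewrite -powRrM -powRD; last by rewrite en implybT.
    rewrite -[LHS]powRr1 //; congr (_ `^ _); rewrite /rate.
    by field; rewrite gt_eqF.
  by rewrite ler_wpM2l ?powR_ge0 // ge0_ler_powR ?nnegrE ?powR_ge0 ?(ltW r0) ?divr_ge0.
apply: (@le_trans _ _ (\sum_(nu <- mi_box n) e nu `^ s * (S / N%:R) `^ rate s)).
  rewrite big_mkcond; apply: ler_sum => nu _; case: ifP => [/pt //|_].
  by rewrite mulr_ge0 ?powR_ge0.
rewrite -mulr_suml; apply: (@le_trans _ _ (S * (S / N%:R) `^ rate s)).
  by rewrite ler_wpM2r ?powR_ge0.
rewrite powRM ?invr_ge0 // mulrA.
have -> : S * S `^ rate s = S `^ s^-1.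
  rewrite -{1}[S]powRr1 // -powRD; first by congr (_ `^ _); rewrite /rate; ring.
  by rewrite /rate addrC subrK invr_eq0 gt_eqF.
by rewrite -[N%:R^-1]powR_inv1 ?ler0n // -powRrM mulN1r.
Qed.

(** The bound with q at nu is asked for all mu above nu: q comes from weights that may vary with nu,
    so it need not be monotone. *)
Lemma majorized_envelope theta (q : multi_index -> R) (s c C : R) L :
  (forall nu, 0 <= theta nu) -> 0 <= c -> (forall nu, 0 <= q nu) ->
  (forall nu mu, mi_le nu mu -> theta mu <= c * q nu) ->
  0 < s < 1 -> (forall n, \sum_(nu <- mi_box n) q nu `^ s <= C) ->
  largest_index_sets theta L ->
  (lm_norm s theta < +oo)%E /\
  forall N, (1 <= N)%N -> exists r : R,
    (r%:E = lm_norm s theta * (N%:R `^ (- rate s))%:E)%E /\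
    forall n, \sum_(nu <- mi_box n | nu \notin L N) theta nu <= r.
Proof.
move=> t0 c0 q0 tq s01 hC hL; have /andP[s0 _] := s01.
have Eq nu : (envelope theta nu <= (c * q nu)%:E)%E by apply: envelope_le => mu /tq.
have E0 nu : (0 <= envelope theta nu)%E by exact: envelope_ge0.
have Efin nu : envelope theta nu \is a fin_num.
  by rewrite ge0_fin_numE // (le_lt_trans (Eq nu)) ?ltry.
pose e nu := fine (envelope theta nu).
have eE nu : envelope theta nu = (e nu)%:E by rewrite fineK.
have e0 nu : 0 <= e nu by exact: fine_ge0.
have ec nu : e nu <= c * q nu by rewrite -lee_fin -eE.
have eC n : \sum_(nu <- mi_box n) e nu `^ s <= c `^ s * C.
  apply: (@le_trans _ _ (\sum_(nu <- mi_box n) c `^ s * q nu `^ s)).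
    apply: ler_sum => nu _; rewrite -powRM //.
    by apply: ge0_ler_powR; rewrite ?nnegrE ?(ltW s0) ?mulr_ge0.
  by rewrite -mulr_sumr; apply: ler_wpM2l; [exact: powR_ge0|exact: hC].
have [S [lmE S0 hS]] := envelope_real s0 eE e0 eC.
rewrite lmE; split=> [|N N1]; first by rewrite ltry.
exists (S `^ s^-1 * N%:R `^ (- rate s)); split=> [|n]; first by rewrite EFinM.
apply: le_trans (stechkin n s01 N1 eE e0 hS hL).
by apply: ler_sum => nu _; rewrite -lee_fin -eE le_envelope.
Qed.

Lemma norm_mi_pow (y : nat -> R) nu : param_box y -> `|mi_pow y nu| <= 1.
Proof.
move=> yb; rewrite /mi_pow normr_prod; apply: prodr_ile1 => j _.
by rewrite normrX exprn_ge0 //= exprn_ile1 // ler_norml; exact: yb.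
Qed.

(** Convergence along boxes suffices: L sits inside a large box, and what is left is the part of the
    box outside L. *)
Lemma taylor_error_le (H : normedModType R) (psi : (nat -> R) -> H)
    (L : {fset multi_index}) (c : R) :
  (forall y, param_box y -> forall eps : R, 0 < eps -> exists m0, forall m, (m0 <= m)%N ->
     `|psi y - taylor_sum psi (mi_box m) y| <= eps) ->
  (forall n, \sum_(nu <- mi_box n | nu \notin L) `|taylor_coef psi nu| <= c) ->
  (taylor_error psi L <= c%:E)%E.
Proof.
move=> conv hc; apply: ge_ereal_sup => _ [y yb <-]; rewrite lee_fin.
apply/ler_addgt0Pl => eps eps0; have [m0 hm] := conv y yb eps eps0.
have [k Lk] := seq_mi_box L; pose m := maxn m0 k.
have Lm : {subset L <= mi_box m}.
  by move=> nu /Lk; apply: mi_box_le; exact: leq_maxr.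
have -> : psi y - taylor_sum psi L y = psi y - taylor_sum psi (mi_box m) y +
    \sum_(nu <- mi_box m | nu \notin L) mi_pow y nu *: taylor_coef psi nu.
  rewrite -addrA; congr (_ + _); rewrite /taylor_sum [X in - X + _](bigID (mem L)) /=.
  rewrite opprD -addrA addNr addr0; congr (- _); rewrite -[RHS]big_filter; apply: perm_big.
  apply: uniq_perm; rewrite ?seq.filter_uniq ?fset_uniq // => x.
  by rewrite mem_filter; apply/idP/andP => [xA|[] //]; split=> //; exact: Lm.
apply: (le_trans (ler_normD _ _)); apply: lerD; first by apply: hm; exact: leq_maxl.
apply: (le_trans (ler_norm_sum _ _ _)); apply: le_trans (hc m).
apply: ler_sum => nu _; rewrite normrZ ler_piMl //; exact: norm_mi_pow.
Qed.

End BestApproximation.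

(** * Convergence of the Taylor series *)

Lemma bounded_mono_tail (R : realType) (S : nat -> R) (C : R) :
  (forall n m, (n <= m)%N -> S n <= S m) -> (forall n, S n <= C) ->
  forall e : R, 0 < e -> exists k, forall m, S m <= S k + e.
Proof.
move=> mono hC e e0.
have hs : has_sup (range S).
  by split; [exists (S 0%N), 0%N|exists C => _ [n _ <-]].
have [_ [k _ <-] Sk] := sup_adherent e0 hs; exists k => m.
have : S m <= sup (range S) by apply: (ub_le_sup hs.2); exists m.
lra.
Qed.

Lemma sum_ord_mono (R : realType) (F : nat -> R) (P : pred nat) n m :
  (forall j, 0 <= F j) -> (n <= m)%N ->
  \sum_(j < n | P j) F j <= \sum_(j < m | P j) F j.
Proof.
move=> F0 nm; rewrite (big_ord_widen_cond m P F nm) big_mkcond [leRHS]big_mkcond.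
by apply: ler_sum => j _; case: (P j) => //=; case: ifP.
Qed.

Lemma sum_tail (R : realType) (F : nat -> R) (C : R) :
  (forall j, 0 <= F j) -> (forall n, \sum_(j < n) F j <= C) ->
  forall e : R, 0 < e -> exists J, forall n, \sum_(j < n | (J <= j)%N) F j <= e.
Proof.
move=> F0 hC e e0; have mono n m := @sum_ord_mono _ F xpredT n m F0.
have [J hJ] := bounded_mono_tail mono hC e0; exists J => n.
have := hJ (maxn J n); rewrite (bigID (fun j : 'I_(maxn J n) => (j < J)%N)) /=.
rewrite -(big_ord_widen _ F (leq_maxl J n)) lerD2l; apply: le_trans.
rewrite (eq_bigl (fun j : 'I_(maxn J n) => (J <= j)%N)) => [|j]; last by rewrite -leqNgt.
exact: (@sum_ord_mono _ F (fun j => J <= j)%N _ _ F0 (leq_maxr J n)).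
Qed.

Lemma mi_box_tail (R : realType) (F : multi_index -> R) (C : R) :
  (forall nu, 0 <= F nu) -> (forall n, \sum_(nu <- mi_box n) F nu <= C) ->
  forall e : R, 0 < e ->
  exists k, forall m, \sum_(nu <- mi_box m | nu \notin mi_box k) F nu <= e.
Proof.
move=> F0 hC e e0.
have mono n m : (n <= m)%N -> \sum_(nu <- mi_box n) F nu <= \sum_(nu <- mi_box m) F nu.
  by move=> nm; apply: sum_le_fset => //; exact: mi_box_le.
have [k hk] := bounded_mono_tail mono hC e0; exists k => m.
have := hk (maxn k m); rewrite (bigID (mem (mi_box k))) /=.
have -> : \sum_(nu <- mi_box (maxn k m) | nu \in mi_box k) F nu = \sum_(nu <- mi_box k) F nu.
  rewrite -[LHS]big_filter; apply: perm_big.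
  apply: uniq_perm; rewrite ?seq.filter_uniq ?fset_uniq // => x.
  rewrite mem_filter; apply/andP/idP => [[] //|xk]; split=> //.
  exact: mi_box_le (leq_maxl _ _) _ xk.
rewrite lerD2l; apply: le_trans; rewrite big_mkcond [leRHS]big_mkcond.
apply: sum_le_fset => [nu|]; first by case: ifP.
exact: mi_box_le (leq_maxr _ _).
Qed.

Section TaylorConvergence.
Context {R : realType} {V Q : normedModType R}.
Context (A0 Ay : {bilinear V -> V -> R | *%R & *%R}).
Context (B : nat -> {bilinear V -> V -> R | *%R & *%R}).
Context (b : {bilinear V -> Q -> R | *%R & *%R}).
Context (f : V -> R) (g : Q -> R).
Context (T : multi_index -> V) (P : multi_index -> Q) (y : nat -> R) (uy : V) (py : Q).
Context (alpha gamma beta Ts Bs : R) (bb : nat -> R).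
Hypotheses (al0 : 0 < alpha) (ga0 : 0 <= gamma) (be0 : 0 < beta).
Hypotheses (hA : continuous_form Ay gamma) (hAc : coercive_on (kernel_space b) Ay alpha).
Hypothesis hinf : inf_sup_condition b beta.
Hypothesis hrec : forall n (nu : multi_index), nu \in mi_box n -> nu != mi0 ->
  (forall v, A0 (T nu) v + b v (P nu) =
    - \sum_(j < n | (0 < nu j)%N) B j (T (mi_pred nu j)) v) /\
  (forall q, b (T nu) q = 0).
Hypothesis hrec0 : saddle_point_solution A0 b f g (T mi0) (P mi0).
Hypothesis hup : saddle_point_solution Ay b f g uy py.
Hypothesis yb : param_box y.
Hypothesis hB : forall j, continuous_form (B j) (bb j).
Hypotheses (bb0 : forall j, 0 <= bb j) (hbb : forall n, \sum_(j < n) bb j <= Bs).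
Hypothesis hT : forall n, \sum_(nu <- mi_box n) `|T nu| <= Ts.
Hypothesis hAy : forall e : R, 0 < e -> exists n0, forall n, (n0 <= n)%N ->
  forall w v, `|Ay w v - A0 w v - \sum_(j < n) y j * B j w v| <= e * `|w| * `|v|.
Implicit Types (nu mu : multi_index).

Let U m := \sum_(nu <- mi_box m) mi_pow y nu *: T nu.
Let W m := \sum_(nu <- mi_box m) mi_pow y nu *: P nu.

Let G v j mu := y j * mi_pow y mu * B j (T mu) v.

(** The recurrence is summed with the factors y^nu and reindexed by mu = nu - e_j, which only
    reaches those mu whose successor is again in the box. *)
Let galerkin m v : A0 (U m) v + b v (W m) =
  f v - \sum_(j < m) \sum_(mu <- mi_box m | mi_succ mu j \in mi_box m) G v j mu.
Proof.
rewrite /U /W linear_sumlz linear_sumr -big_split /= (big_rem _ (mi0_box m)).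
rewrite !mi_pow0 !scale1r hrec0.1 rem_filter ?fset_uniq // big_filter; congr (_ + _).
transitivity (\sum_(nu <- mi_box m) - \sum_(j < m | (0 < nu j)%N) G v j (mi_pred nu j)).
  rewrite [RHS](big_rem _ (mi0_box m)) rem_filter ?fset_uniq //= big_filter.
  rewrite [X in - X + _]big1 ?oppr0 ?add0r => [|j]; last by rewrite mi0E.
  rewrite big_seq_cond [RHS]big_seq_cond; apply: eq_bigr => nu /andP[num nu0].
  rewrite linearZl_LR linearZr_LR /= -mulrDr (hrec num nu0).1 mulrN mulr_sumr.
  by congr (- _); apply: eq_bigr => j nuj; rewrite /G -mi_pow_pred.
rewrite sumrN; congr (- _); under [LHS]eq_bigr do rewrite big_mkcond.
rewrite [LHS]exchange_big; apply: eq_bigr => j _.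
by rewrite -big_mkcond (sum_mi_pred (G v j) (ltn_ord j)).
Qed.

(** Two errors remain: the pairs (mu, j) for which mu + e_j leaves the box, and the part of the
    affine form beyond n variables. The left-hand side does not involve n, which can still be taken
    large. *)
Let residual m n v : (m <= n)%N ->
  Ay (uy - U m) v + b v (py - W m) =
  - (\sum_(j < n) \sum_(mu <- mi_box m | mi_succ mu j \notin mi_box m) G v j mu)
  - (Ay (U m) v - A0 (U m) v - \sum_(j < n) y j * B j (U m) v).
Proof.
move=> mn; rewrite linearBl linearBr /=.
have e1 := hup.1 v; have e2 := galerkin m v.
have e3 : \sum_(j < n) y j * B j (U m) v = \sum_(j < n) \sum_(mu <- mi_box m) G v j mu.
  apply: eq_bigr => j _; rewrite /U linear_sumlz mulr_sumr; apply: eq_bigr => mu _.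
  by rewrite linearZl_LR /G mulrA.
have e4 : \sum_(j < n) \sum_(mu <- mi_box m) G v j mu =
    \sum_(j < m) \sum_(mu <- mi_box m | mi_succ mu j \in mi_box m) G v j mu +
    \sum_(j < n) \sum_(mu <- mi_box m | mi_succ mu j \notin mi_box m) G v j mu.
  under eq_bigr => j _ do rewrite (bigID (fun mu => mi_succ mu j \in mi_box m)) /=.
  rewrite big_split /=; congr (_ + _).
  rewrite (big_ord_widen n (fun j => \sum_(mu <- mi_box m | mi_succ mu j \in mi_box m) G v j mu) mn).
  rewrite [RHS]big_mkcond; apply: eq_bigr => j _; case: ifPn => //; rewrite -leqNgt => mj.
  rewrite big_seq_cond big1 // => mu /andP[mum].
  by rewrite mi_succ_box // ltnNge mj.
by rewrite e3 e4; lra.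
Qed.

Let U_le m : `|U m| <= Ts.
Proof.
apply: (le_trans (ler_norm_sum _ _ _)); apply: le_trans (hT m).
by apply: ler_sum => nu _; rewrite normrZ ler_piMl // norm_mi_pow.
Qed.

Let U_ker m : kernel_space b (uy - U m).
Proof.
move=> q; rewrite linearBl hup.2 /U linear_sumlz (big_rem _ (mi0_box m)).
rewrite mi_pow0 scale1r hrec0.2 rem_filter ?fset_uniq // big_filter.
rewrite big_seq_cond big1 /= ?addr0 ?subrr // => nu /andP[num nu0].
by rewrite linearZl_LR (hrec num nu0).2 mulr0.
Qed.

Let Ts0 : 0 <= Ts.
Proof. by apply: le_trans (U_le 0). Qed.

Let Bs0 : 0 <= Bs.
Proof. by apply: le_trans (hbb 0); rewrite big_ord0. Qed.

(** If mu + e_j leaves the box of a large m, then mu lies outside the fixed box k or j >= J. The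
    first case is controlled by the tail of the norms of T, the second by the tail of [bb]. *)
Let boundary_sum (e : R) : 0 < e -> exists m0, forall m, (m0 <= m)%N -> forall n,
  \sum_(j < n) \sum_(mu <- mi_box m | mi_succ mu j \notin mi_box m) bb j * `|T mu|
  <= e * (Bs + Ts).
Proof.
move=> e0; have [k hk] := mi_box_tail (fun nu => normr_ge0 (T nu)) hT e0.
have [J hJ] := sum_tail bb0 hbb e0.
exists (maxn k J).+1 => m; rewrite gtn_max => /andP[km Jm] n.
apply: (@le_trans _ _ (\sum_(j < n) (bb j * e + (if (J <= j)%N then bb j else 0) * Ts))).
  apply: ler_sum => j _.
  apply: (@le_trans _ _ (\sum_(mu <- mi_box m)
     ((if mu \notin mi_box k then bb j * `|T mu| else 0) +
      (if (J <= j)%N then bb j else 0) * `|T mu|))).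
    rewrite big_mkcond big_seq [leRHS]big_seq; apply: ler_sum => mu mum.
    have t1 : 0 <= (if mu \notin mi_box k then bb j * `|T mu| else 0).
      by case: ifP => // _; rewrite mulr_ge0.
    have t2 : 0 <= (if (J <= j)%N then bb j else 0) * `|T mu|.
      by rewrite mulr_ge0 //; case: ifP.
    case: ifP => [|_]; last exact: addr_ge0.
    have [muk|muk] := boolP (mu \in mi_box k); last by rewrite lerDl.
    have [Jj|jJ] := leqP J j; first by rewrite add0r.
    rewrite mi_succ_box // (ltn_trans jJ Jm) (leq_ltn_trans _ km) //.
    by have /mi_boxP[] := muk.
  rewrite big_split /= -big_mkcond -!mulr_sumr; apply: lerD; apply: ler_wpM2l => //.
  by case: ifP.
rewrite big_split /= -!mulr_suml -big_mkcond mulrDr; apply: lerD.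
  by rewrite mulrC; apply: ler_wpM2l; [exact: ltW|exact: hbb].
by rewrite ler_wpM2r //; exact: hJ.
Qed.

Lemma taylor_converges (e : R) : 0 < e -> exists m0, forall m, (m0 <= m)%N ->
  `|uy - U m| <= e /\ `|py - W m| <= e.
Proof.
(* Bs + Ts comes from the boundary terms, the second Ts from the affine remainder, and 1 ensures
   positivity; the second factor adds the stability constants for u and p. *)
move=> e0; pose N := (Bs + Ts + Ts + 1) * (1 / alpha + (1 + gamma / alpha) / beta).
have N1 : 0 < Bs + Ts + Ts + 1 by rewrite ltr_wpDl // !addr_ge0.
have N2 : 0 < 1 / alpha + (1 + gamma / alpha) / beta.
  rewrite ltr_pwDl //; first by rewrite divr_gt0.
  by rewrite divr_ge0 ?(ltW be0) // addr_ge0 // divr_ge0 // ltW.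
have N0 : 0 < N by rewrite mulr_gt0.
have e1 : 0 < e / N by rewrite divr_gt0.
have [m0 hm] := boundary_sum e1; have [n0 hn] := hAy e1.
exists m0 => m m0m; pose M := e / N * (Bs + Ts + Ts + 1).
have M0 : 0 <= M by rewrite mulr_ge0 ?addr_ge0 // ltW.
pose n := maxn m n0; have mn : (m <= n)%N by exact: leq_maxl.
have Phi v : `|- (\sum_(j < n) \sum_(mu <- mi_box m | mi_succ mu j \notin mi_box m) G v j mu)
  - (Ay (U m) v - A0 (U m) v - \sum_(j < n) y j * B j (U m) v)| <= M * `|v|.
  have -> : M * `|v| = e / N * (Bs + Ts) * `|v| + (e / N * Ts + e / N) * `|v|.
    by rewrite /M; ring.
  apply: (le_trans (ler_normB _ _)); rewrite normrN; apply: lerD.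
    apply: le_trans (_ : (\sum_(j < n) \sum_(mu <- mi_box m | mi_succ mu j \notin mi_box m)
       bb j * `|T mu|) * `|v| <= _); last by rewrite ler_wpM2r // hm.
    rewrite mulr_suml; apply: (le_trans (ler_norm_sum _ _ _)); apply: ler_sum => j _.
    rewrite mulr_suml; apply: (le_trans (ler_norm_sum _ _ _)); apply: ler_sum => mu _.
    rewrite /G !normrM -[leRHS]mul1r; apply: ler_pM => //.
      by rewrite mulr_ile1 // ?norm_mi_pow // ler_norml; exact: yb.
    exact: continuous_form_norm.
  apply: le_trans (hn n (leq_maxr _ _) _ _) _; rewrite ler_wpM2r //.
  by rewrite ler_wpDr ?(ltW e1) // ler_wpM2l // ltW.
have [s1 s2] := @saddle_stability _ _ _ b Ay alpha gamma beta M (uy - U m) (py - W m) _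
  al0 ga0 M0 hinf (continuous_form_norm hA) hAc (U_ker m) (fun v => residual v mn) Phi.
have t1 : `|uy - U m| <= M / alpha by rewrite ler_pdivlMr // mulrC.
have t2 : `|py - W m| <= (M + gamma * (M / alpha)) / beta.
  rewrite ler_pdivlMr // mulrC; apply: (le_trans s2).
  by rewrite lerD2l ler_wpM2l.
have eE : e = M / alpha + (M + gamma * (M / alpha)) / beta.
  rewrite -[LHS](divfK (lt0r_neq0 N0)) /M; move: (e / N) => k; rewrite /N.
  by field; rewrite !gt_eqF.
have u1 : 0 <= M / alpha by rewrite divr_ge0 // ltW.
have u2 : 0 <= (M + gamma * (M / alpha)) / beta.
  by rewrite divr_ge0 ?(ltW be0) // addr_ge0 // mulr_ge0.
by split; lra.
Qed.

End TaylorConvergence.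

(** * Weights adapted to the multi-index *)

Section AdaptiveWeights.
Context {R : realType}.
Implicit Types (nu mu : multi_index) (x s t : R).

Lemma geometric_sum_le x n : 0 <= x < 1 -> \sum_(k < n) x ^+ k <= (1 - x)^-1.
Proof.
move=> /andP[x0 x1]; elim: n => [|n IH].
  by rewrite big_ord0 invr_ge0 subr_ge0 ltW.
rewrite big_ord_recl expr0; under eq_bigr do rewrite exprS.
rewrite -mulr_sumr; apply: le_trans (_ : 1 + x * (1 - x)^-1 <= _).
  by rewrite lerD2l ler_wpM2l.
by rewrite le_eqVlt; apply/predU1P; left; field; rewrite subr_eq0 gt_eqF.
Qed.

Lemma exp_sum_le x n : 0 <= x -> \sum_(k < n) x ^+ k / (k`!)%:R <= expR x.
Proof.
move=> x0; have := @nondecreasing_cvgn_le _ (series (exp_coeff x)) _ (is_cvg_series_exp_coeff x) n.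
rewrite /series /= big_mkord; apply.
by apply: nondecreasing_series => k _ _; exact: exp_coeff_ge0.
Qed.

Lemma expR_sum_ord (a : nat -> R) n (P : pred 'I_n) :
  \prod_(j < n | P j) expR (a j) = expR (\sum_(j < n | P j) a j).
Proof. by rewrite (big_morph expR (@expRD R) (@expR0 R)). Qed.

(** Only finitely many x_j can exceed 1/2, so all are at most some q < 1; then 1 / (1 - x) = 1 + x /
    (1 - x) <= exp(x / (1 - q)). *)
Lemma prod_geometric_bounded (x : nat -> R) (C : R) :
  (forall j, 0 <= x j < 1) -> (forall n, \sum_(j < n) x j <= C) ->
  exists D, forall n, \prod_(j < n) \sum_(k < n.+1) x j ^+ k <= D.
Proof.
move=> x01 hC; have x0 j : 0 <= x j by case/andP: (x01 j).
have [J hJ] := sum_tail x0 hC (ltac:(lra) : 0 < (1 / 2 : R)).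
have [q q1 hq] : exists2 q : R, q < 1 & forall j, x j <= q.
  have : exists2 q : R, q < 1 & forall j, (j < J)%N -> x j <= q.
    elim: (J) => [|K [q q1 hq]]; first by exists 0.
    have /andP[_ xK] := x01 K; exists (Order.max q (x K)); first by rewrite gt_max q1.
    by move=> j; rewrite ltnS leq_eqVlt le_max => /orP[/eqP ->|/hq ->]; rewrite ?lexx ?orbT.
  move=> [q q1 hq]; exists (Order.max q (1 / 2)); first by rewrite gt_max q1; lra.
  move=> j; rewrite le_max; have [Jj|/hq -> //] := leqP J j.
  apply/orP; right; apply: le_trans (hJ j.+1).
  by rewrite big_mkcond big_ord_recr /= Jj lerDr sumr_ge0 // => i _; case: ifP.
have q0 : 0 <= q by exact: le_trans (hq 0%N).
exists (expR (C / (1 - q))) => n.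
apply: (@le_trans _ _ (\prod_(j < n) expR (x j / (1 - q)))).
  apply: ler_prod => j _; have /andP[xj0 xj1] := x01 j.
  rewrite sumr_ge0 => [/=|k _]; last exact: exprn_ge0.
  apply: le_trans (geometric_sum_le _ (x01 j)) _; apply: le_trans (expR_ge1Dx _).
  have -> : (1 - x j)^-1 = 1 + x j / (1 - x j).
    by field; rewrite subr_eq0 gt_eqF.
  by rewrite lerD2l ler_wpM2l // lef_pV2 ?posrE ?subr_gt0 // lerD2l lerN2.
rewrite (expR_sum_ord (fun j => x j / (1 - q))) ler_expR -mulr_suml ler_wpM2r //.
by rewrite invr_ge0 subr_ge0 ltW.
Qed.

Lemma fact_le_exp k : (k`! <= k ^ k)%N.
Proof.
have h m : (k <= m -> k`! <= m ^ k)%N.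
  elim: k => // k IH km; rewrite factS expnS leq_mul // IH //; exact: ltnW.
exact: h.
Qed.

Definition tail_deg (J : nat) nu : nat :=
  (\sum_(j <- finsupp nu) (if (J <= j)%N then nu j else 0))%N.

Lemma tail_degE J nu n : nu \in mi_box n ->
  tail_deg J nu = (\sum_(j < n | (J <= j)%N) nu j)%N.
Proof.
move=> /mi_boxP[_ nun]; rewrite big_mkcond.
by rewrite /tail_deg (@big_finsupp _ _ _ (fun j k => if (J <= j)%N then k else 0%N) _ n) // => j; case: ifP.
Qed.

(* With m the tail degree and G as in the proof, m^m = G^m (m/G)^m, where the
   second factor joins the product over j: for each value of m the sum over the
   multi-indices then factorizes into exponential series bounded by exp(m/G g_j). *)
Lemma multinomial_sum_bounded (J : nat) (tau : R) (gw : nat -> R) :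
  0 <= tau < 1 -> (forall j, 0 <= gw j) ->
  (forall n, \sum_(j < n | (J <= j)%N) gw j <= (2 * expR 1)^-1) ->
  exists C, forall n, \sum_(nu <- mi_box n)
    \prod_(j < n) (if (j < J)%N then tau else (tail_deg J nu)%:R * gw j / (nu j)%:R) ^+ nu j
    <= C.
Proof.
move=> tau01 g0 hg; have /andP[tau0 tau1] := tau01; pose G : R := (2 * expR 1)^-1.
have G0 : 0 < G by rewrite invr_gt0 mulr_gt0 // expR_gt0.
pose p (l : R) (j k : nat) : R :=
  if (j < J)%N then tau ^+ k else (l * gw j) ^+ k / (k`!)%:R.
have p0 l j k : 0 <= l -> 0 <= p l j k.
  move=> l0; rewrite /p; case: ifP => _; first exact: exprn_ge0.
  by rewrite divr_ge0 // exprn_ge0 // mulr_ge0.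
have i0 (i : nat) : 0 <= i%:R / G by rewrite divr_ge0 // ltW.
have pt n nu : nu \in mi_box n ->
    \prod_(j < n) (if (j < J)%N then tau else (tail_deg J nu)%:R * gw j / (nu j)%:R) ^+ nu j
    <= \sum_(i < (n * n).+1) G ^+ i * \prod_(j < n) p (i%:R / G) j (nu j).
  move=> nub; set m := tail_deg J nu.
  have mn : (m < (n * n).+1)%N.
    rewrite ltnS /m (tail_degE J nub) big_mkcond.
    apply: (@leq_trans (\sum_(j < n) n)%N); last by rewrite sum_nat_const card_ord.
    by apply: leq_sum => j _; case: ifP => // _; have /mi_boxP[] := nub.
  (* The term i = m already dominates the product; the other terms only decouple i from nu. *)
  rewrite (bigD1 (Ordinal mn)) //= ler_wpDr //.
    apply: sumr_ge0 => i _; rewrite mulr_ge0 ?exprn_ge0 ?(ltW G0) //.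
    by apply: prodr_ge0 => j _; exact: p0.
  have -> : G ^+ m = \prod_(j < n | (J <= j)%N) G ^+ nu j.
    by rewrite /m (tail_degE J nub) expr_sum.
  rewrite [X in _ <= X * _]big_mkcond -big_split /=; apply: ler_prod => j _.
  rewrite exprn_ge0 /=; last by case: ifP => // _; rewrite divr_ge0 ?mulr_ge0.
  rewrite /p; case: (ltnP j J) => jJ; first by rewrite mul1r.
  have -> : G ^+ nu j * ((m%:R / G * gw j) ^+ nu j / ((nu j)`!)%:R) =
      (m%:R * gw j) ^+ nu j / ((nu j)`!)%:R.
    by rewrite mulrA -exprMn; congr (_ ^+ _ / _); field; rewrite gt_eqF.
  rewrite exprMn ler_wpM2l //.
    by rewrite exprn_ge0 // mulr_ge0.
  rewrite exprVn lef_pV2 ?posrE ?ltr0n ?fact_gt0 -?natrX ?ltr0n ?expn_gt0 //; last by case: (nu j).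
  by rewrite ler_nat fact_le_exp.
exists (2 * ((1 - tau)^-1) ^+ J) => n.
apply: (@le_trans _ _ (\sum_(nu <- mi_box n)
    \sum_(i < (n * n).+1) G ^+ i * \prod_(j < n) p (i%:R / G) j (nu j))).
  by rewrite big_seq [leRHS]big_seq; apply: ler_sum => nu; exact: pt.
rewrite exchange_big /=.
have tau1' : 1 <= (1 - tau)^-1.
  by rewrite invf_ge1 ?subr_gt0 // lerBlDr lerDl.
apply: (@le_trans _ _ (\sum_(i < (n * n).+1) (1 / 2) ^+ i * ((1 - tau)^-1) ^+ J)); last first.
  rewrite -mulr_suml ler_wpM2r ?exprn_ge0 ?(le_trans _ tau1') //.
  apply: le_trans (geometric_sum_le _ _) _; first by lra.
  by rewrite (_ : 1 - 1 / 2 = 2^-1) ?invrK //; lra.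
apply: ler_sum => i _; rewrite -mulr_sumr (sum_box_prod (p (i%:R / G))).
(* G is the bound on the tail sums of [gw], so the exponentials multiply to at most e^i, and G^i e^i
   = 2^-i is summable in i. *)
have -> : (1 / 2 : R) = G * expR 1.
  by rewrite /G; field; rewrite gt_eqF // expR_gt0.
rewrite exprMn -mulrA ler_wpM2l ?exprn_ge0 ?(ltW G0) //.
apply: (@le_trans _ _ (\prod_(j < n) ((if (J <= j)%N then expR (i%:R / G * gw j) else 1) *
   (if (j < J)%N then (1 - tau)^-1 else 1)))).
  apply: ler_prod => j _; rewrite sumr_ge0 /= => [|k _]; last exact: p0.
  rewrite /p; case: (ltnP j J) => jJ; last first.
    by rewrite mulr1; apply: exp_sum_le; rewrite mulr_ge0.
  by rewrite mul1r; exact: geometric_sum_le.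
rewrite big_split /= -big_mkcond /= (expR_sum_ord (fun j => i%:R / G * gw j)).
apply: ler_pM; rewrite ?expR_ge0 //.
- by apply: prodr_ge0 => j _; case: ifP => // _; rewrite (le_trans _ tau1').
- rewrite -expRM_natl ler_expR mulr1 -mulr_sumr -mulrA -[leRHS]mulr1 ler_wpM2l //.
  by rewrite ler_pdivrMl // mulr1; exact: hg.
rewrite -big_mkcond prodr_const; apply: ler_weXn2l => //.
rewrite cardE -(size_map val) -[leqRHS](size_iota 0 J); apply: uniq_leq_size.
  by rewrite (map_inj_uniq val_inj) enum_uniq.
by move=> j /mapP[l]; rewrite mem_enum mem_iota => lJ ->.
Qed.


Lemma powR_prod (I : Type) (r : seq I) (P : pred I) (a : I -> R) (t : R) :
  (forall i, 0 <= a i) ->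
  (\prod_(i <- r | P i) a i) `^ t = \prod_(i <- r | P i) a i `^ t.
Proof.
move=> a0; have [] : 0 <= \prod_(i <- r | P i) a i /\
    (\prod_(i <- r | P i) a i) `^ t = \prod_(i <- r | P i) a i `^ t; last by [].
apply: (big_rec2 (fun x y : R => 0 <= x /\ x `^ t = y)); first by rewrite powR1.
by move=> i x y _ [x0 <-]; rewrite mulr_ge0 // powRM.
Qed.

Lemma powRX (a t : R) k : 0 <= a -> (a ^+ k) `^ t = (a `^ t) ^+ k.
Proof.
move=> a0; elim: k => [|k IH]; first by rewrite !expr0 powR1.
by rewrite !exprS powRM ?exprn_ge0 // IH.
Qed.

(** Young's inequality for the exponents 1 / s and 1 / (1 - s), with both constants replaced by 1.
    It will split the inverse weights into a multinomial and a geometric part that are summed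
    separately. *)
Lemma powR_young (x z s : R) : 0 <= x -> 0 <= z -> 0 < s < 1 ->
  (x * z) `^ s <= x + z `^ (s / (1 - s)).
Proof.
move=> x0 z0 /andP[s0 s1]; have s1' : 0 < 1 - s by rewrite subr_gt0.
pose w := z `^ (1 - s)^-1.
have zw : z = w `^ (1 - s) by rewrite /w -powRrM mulVf ?gt_eqF // powRr1.
have w0 : 0 <= w by exact: powR_ge0.
have -> : z `^ (s / (1 - s)) = w `^ s by rewrite /w -powRrM mulrC.
rewrite powRM // {1}zw -powRrM.
have [xw|wx] := leP x (w `^ s).
  rewrite ler_wpDl //; apply: (@le_trans _ _ ((w `^ s) `^ s * w `^ ((1 - s) * s))).
    apply: ler_wpM2r; first exact: powR_ge0.
    by apply: ge0_ler_powR; rewrite ?nnegrE ?(ltW s0) //; exact: powR_ge0.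
  rewrite -powRrM; have [->|wn] := eqVneq w 0.
    by rewrite !powR0 ?mul0r // ?mulf_neq0 // ?gt_eqF.
  rewrite -powRD; last by rewrite wn implybT.
  by rewrite (_ : s * s + (1 - s) * s = s) //; ring.
rewrite ler_wpDr ?powR_ge0 //; apply: (@le_trans _ _ (x `^ s * x `^ (1 - s))).
  apply: ler_wpM2l; first exact: powR_ge0.
  rewrite mulrC powRrM; apply: ge0_ler_powR; rewrite ?nnegrE ?(ltW s1') ?(ltW wx) //.
  exact: powR_ge0.
have xp : 0 < x by apply: le_lt_trans wx; exact: powR_ge0.
rewrite -powRD; last by rewrite (gt_eqF xp) implybT.
by rewrite addrC subrK powRr1.
Qed.

(* The weights are chosen, as in Cohen-DeVore-Schwab, to nearly maximize rho^nu
   under the budget constraint: constant on the first J variables, and essentially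
   proportional to nu_j / (|nu| b_j) on the others. *)
Lemma adaptive_weights (b : nat -> R) (s eta C : R) :
  (forall j, 0 <= b j) -> 0 < s < 1 -> 0 < eta ->
  (forall n, \sum_(j < n) b j `^ s <= C) ->
  exists (rho : multi_index -> nat -> R) (D : R),
    [/\ forall nu j, 1 <= rho nu j,
        forall nu n, \sum_(j < n) (rho nu j - 1) * b j <= eta &
        forall n, \sum_(nu <- mi_box n) ((mi_pow (rho nu) nu)^-1) `^ s <= D].
Proof.
move=> b0 s01 eta0 hC; have /andP[s0 s1] := s01.
have s1' : 0 < 1 - s by rewrite subr_gt0.
(* The summand 2^-j keeps [gw], and so [bt], positive where b_j = 0. *)
pose gw j := b j `^ s + (1 / 2) ^+ j.
have g0 j : 0 < gw j by rewrite ltr_wpDl ?powR_ge0 // exprn_gt0.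
have gC n : \sum_(j < n) gw j <= C + 2.
  rewrite big_split /=; apply: lerD; first exact: hC.
  apply: le_trans (geometric_sum_le _ _) _; first by lra.
  by rewrite (_ : 1 - 1 / 2 = 2^-1) ?invrK //; lra.
pose bt j := gw j `^ s^-1.
have bt0 j : 0 < bt j by exact: powR_gt0.
have b_bt j : b j <= bt j.
  rewrite -[b j]powRr1 // -(divff (lt0r_neq0 s0)) powRrM.
  by rewrite ge0_ler_powR ?nnegrE ?powR_ge0 ?invr_ge0 ?(ltW s0) ?(ltW (g0 _)) // lerDl exprn_ge0.
pose t := s / (1 - s); have t0 : 0 < t by rewrite divr_gt0.
pose K := (2 / eta) `^ t; have K0 : 0 <= K by exact: powR_ge0.
pose G : R := (2 * expR 1)^-1.
have G0 : 0 < G by rewrite invr_gt0 mulr_gt0 // expR_gt0.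
(* The first bound is the one required by [multinomial_sum_bounded]; the second makes K gw_j < 1 for
   j >= J. *)
pose h := Order.min G (2 * (K + 1))^-1.
have h0 : 0 < h by rewrite lt_min G0 invr_gt0 mulr_gt0 // ltr_wpDl.
have [J hJ] := sum_tail (fun j => ltW (g0 j)) gC h0.
pose Sb := \sum_(j < J) b j; have Sb0 : 0 <= Sb by exact: sumr_ge0.
pose ep := eta / (2 * (1 + Sb)).
have ep0 : 0 < ep by rewrite divr_gt0 // mulr_gt0 // ltr_pwDl.
(* As e' <= 1, (1 + e')^2 - 1 <= 3 e' <= ep. The weight is a square because the factors X and Y
   below each use up one [tau]. *)
pose e' := Order.min 1 ep / 3.
have e'0 : 0 < e' by rewrite divr_gt0 // lt_min ep0 ltr01.
have [e'1 e'ep] : e' <= 1 / 3 /\ e' <= ep / 3.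
  by rewrite /e' !ler_pM2r ?invr_gt0 // !ge_min !lexx orbT.
pose tau := (1 + e')^-1.
have e1' : 0 < 1 + e' by rewrite ltr_pwDl // ltW.
have tau0 : 0 < tau by rewrite invr_gt0.
have tau1 : tau < 1 by rewrite invf_lt1 // ltrDl.
pose kap := (1 + e') ^+ 2.
have kap1 : 1 <= kap by rewrite exprn_ege1 // lerDl ltW.
have kapep : kap - 1 <= ep.
  have : e' * e' <= 1 * e' by rewrite ler_wpM2r ?(ltW e'0) //; lra.
  by rewrite /kap expr2 mulrDl mulrDr; lra.
(* If the tail degree is 0, the quotient is 0 by convention and the weights from J on are 1. *)
pose rho nu j : R := if (j < J)%N then kap
  else 1 + eta / 2 * ((nu j)%:R / ((tail_deg J nu)%:R * bt j)).
have q0 nu j : 0 <= (nu j)%:R / ((tail_deg J nu)%:R * bt j).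
  by rewrite divr_ge0 ?mulr_ge0 // ltW.
have rho1 nu j : 1 <= rho nu j.
  rewrite /rho; case: ifP => // _.
  by rewrite lerDl mulr_ge0 // ltW // divr_gt0.
have hG : h <= G by rewrite ge_min lexx.
have [D1 hD1] := @multinomial_sum_bounded J tau gw (introT andP (conj (ltW tau0) tau1))
  (fun j => ltW (g0 j)) (fun n => le_trans (hJ n) hG).
pose y j : R := if (j < J)%N then tau `^ t else K * gw j.
have y0 j : 0 <= y j by rewrite /y; case: ifP => _; rewrite ?powR_ge0 // mulr_ge0 // ltW.
have ghJ j : (J <= j)%N -> gw j <= h.
  move=> Jj; apply: le_trans (hJ j.+1).
  by rewrite big_mkcond big_ord_recr /= Jj lerDr sumr_ge0 // => i _; case: ifP => // _; exact: ltW.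
have p1 : 1 = 1 `^ t :> R by rewrite powR1.
have y1 j : y j < 1.
  rewrite /y; case: ltnP => jJ.
    by rewrite [ltRHS]p1 gt0_ltr_powR ?nnegrE // ltW.
  apply: (@le_lt_trans _ _ (K * (2 * (K + 1))^-1)).
    by rewrite ler_wpM2l // (le_trans (ghJ _ jJ)) // ge_min lexx orbT.
  by rewrite ltr_pdivrMr ?mulr_gt0 ?ltr_wpDl //; lra.
have yC n : \sum_(j < n) y j <= (K + 2 ^+ J) * (C + 2).
  apply: le_trans (_ : \sum_(j < n) (K + 2 ^+ J) * gw j <= _); last first.
    by rewrite -mulr_sumr ler_wpM2l // addr_ge0 // exprn_ge0.
  apply: ler_sum => j _; rewrite mulrDl /y; case: (ltnP j J) => jJ; last first.
    by rewrite lerDl mulr_ge0 ?exprn_ge0 // ltW.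
  rewrite ler_wpDl ?mulr_ge0 ?(ltW (g0 _)) //; apply: (@le_trans _ _ 1).
    by rewrite [leRHS]p1 ge0_ler_powR ?nnegrE // ltW.
  apply: (@le_trans _ _ (2 ^+ J * (1 / 2) ^+ J)).
    by rewrite -exprMn mul1r divff ?expr1n.
  rewrite ler_wpM2l ?exprn_ge0 //; apply: (@le_trans _ _ ((1 / 2) ^+ j)).
    by apply: ler_wiXn2l; [lra|lra|exact: ltnW].
  by rewrite lerDr powR_ge0.
have [D2 hD2] := prod_geometric_bounded (fun j => introT andP (conj (y0 j) (y1 j))) yC.
exists rho, (D1 + D2); split=> // [nu n|n].
  have [k nuk] := in_mi_box nu; set m := tail_deg J nu.
  apply: (@le_trans _ _ (\sum_(j < n) ((if (j < J)%N then ep * b j else 0) +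
     (if (J <= j)%N then eta / 2 * ((nu j)%:R / m%:R) else 0)))).
    apply: ler_sum => j _; rewrite /rho -/m; case: (ltnP j J) => jJ.
      by rewrite addr0 ler_wpM2r.
    rewrite add0r addrAC subrr add0r -mulrA ler_wpM2l ?divr_ge0 ?(ltW eta0) //.
    have -> : (nu j)%:R / (m%:R * bt j) * b j = (nu j)%:R / m%:R * (b j / bt j).
      by rewrite invfM; ring.
    by rewrite ler_piMr ?divr_ge0 // ler_pdivrMr ?mul1r.
  rewrite big_split /= -!big_mkcond -!mulr_sumr -mulr_suml.
  (* Half of the budget goes to the first J variables and half to the others, where the fractions
     nu_j / m sum to at most 1. *)
  have etaE : eta = ep * (1 + Sb) + eta / 2 * 1.
    by rewrite /ep; field; rewrite gt_eqF // ltr_pwDl.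
  rewrite [leRHS]etaE.
  apply: lerD.
    rewrite ler_wpM2l ?(ltW ep0) //; apply: (@le_trans _ _ Sb); last by rewrite lerDr.
    rewrite /Sb (big_ord_widen (maxn n J) b (leq_maxr n J)).
    exact: (@sum_ord_mono _ b (fun j => j < J)%N _ _ b0 (leq_maxl n J)).
  rewrite ler_wpM2l ?divr_ge0 ?(ltW eta0) //.
  have [->|m0] := eqVneq m 0%N; first by rewrite invr0 mulr0.
  rewrite ler_pdivrMr ?ltr0n ?lt0n // mul1r /m.
  rewrite (tail_degE J (mi_box_le (leq_maxr n k) nuk)) natr_sum.
  exact: (@sum_ord_mono _ (fun j => (nu j)%:R) (fun j => J <= j)%N _ _ (fun j => ler0n _ _) (leq_maxl n k)).
(* Where nu_j > 0, 1 / rho_j <= X Y. On the later variables, bt = gw^(1/s) is split: X keeps one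
   power of gw for the multinomial sum, and Y takes gw^(1/s - 1), whose t-th power is again gw. *)
pose X nu j : R := if (j < J)%N then tau else (tail_deg J nu)%:R * gw j / (nu j)%:R.
pose Y j : R := if (j < J)%N then tau else 2 / eta * (bt j / gw j).
have X0 nu j : 0 <= X nu j.
  by rewrite /X; case: ifP => _; rewrite ?(ltW tau0) // divr_ge0 // mulr_ge0 // ltW.
have Y0 j : 0 <= Y j.
  rewrite /Y; case: ifP => _; first exact: ltW.
  by rewrite mulr_ge0 ?divr_ge0 ?(ltW eta0) // ltW.
have Yt j : Y j `^ t = y j.
  rewrite /Y /y; case: ifP => // _.
  rewrite powRM ?divr_ge0 ?(ltW eta0) ?(ltW (bt0 _)) ?(ltW (g0 _)) //; congr (_ * _).
  have -> : bt j / gw j = gw j `^ (s^-1 - 1).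
    by rewrite powRB ?powRr1 ?(ltW (g0 _)) // (gt_eqF (g0 j)) implybT.
  rewrite -powRrM (_ : _ * t = 1) ?powRr1 ?(ltW (g0 _)) // /t.
  by field; rewrite !gt_eqF.
apply: (@le_trans _ _ (\sum_(nu <- mi_box n)
   (\prod_(j < n) X nu j ^+ nu j + \prod_(j < n) y j ^+ nu j))); last first.
  rewrite big_split /=; apply: lerD; first exact: hD1.
  by rewrite (sum_box_prod (fun j k => y j ^+ k)).
rewrite big_seq [leRHS]big_seq; apply: ler_sum => nu nub.
have -> : \prod_(j < n) y j ^+ nu j = (\prod_(j < n) Y j ^+ nu j) `^ t.
  rewrite powR_prod => [|j]; last exact: exprn_ge0.
  by apply: eq_bigr => j _; rewrite powRX // Yt.
have x0 : 0 <= \prod_(j < n) X nu j ^+ nu j by apply: prodr_ge0 => j _; rewrite exprn_ge0.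
have z0 : 0 <= \prod_(j < n) Y j ^+ nu j by apply: prodr_ge0 => j _; rewrite exprn_ge0.
apply: le_trans (powR_young x0 z0 s01).
rewrite ge0_ler_powR ?nnegrE ?(ltW s0) ?mulr_ge0 //.
  by rewrite invr_ge0 mi_pow_ge0 // => j; rewrite (le_trans _ (rho1 nu j)).
rewrite (mi_pow_box _ nub) -prodfV -big_split /=; apply: ler_prod => j _.
rewrite -exprVn -exprMn exprn_ge0 ?invr_ge0 ?(le_trans _ (rho1 nu j)) //=.
have [->|nuj] := posnP (nu j); first by rewrite !expr0.
apply: lerXn2r; rewrite ?nnegrE ?mulr_ge0 ?invr_ge0 ?(le_trans _ (rho1 nu j)) //.
rewrite /rho /X /Y; case: (ltnP j J) => jJ; first by rewrite /kap /tau expr2 invfM.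
have nuR : 0 < (nu j)%:R :> R by rewrite ltr0n.
have mR : 0 < (tail_deg J nu)%:R :> R.
  rewrite ltr0n (tail_degE J nub).
  have jn : (j < n)%N by [].
  by rewrite (bigD1 j) //= ltn_addr.
have -> : (tail_deg J nu)%:R * gw j / (nu j)%:R * (2 / eta * (bt j / gw j)) =
   (eta / 2 * ((nu j)%:R / ((tail_deg J nu)%:R * bt j)))^-1.
  by field; rewrite !gt_eqF.
have qp : 0 < eta / 2 * ((nu j)%:R / ((tail_deg J nu)%:R * bt j)).
  by rewrite mulr_gt0 // divr_gt0 // mulr_gt0.
by rewrite lef_pV2 ?posrE ?addr_gt0 // lerDr.
Qed.

End AdaptiveWeights.

(** * Null sets and series *)

Section NullSets.
Context {R : realType} {d : nat}.
Implicit Types (D N : set 'rV[R]_d).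

Lemma lebesgue_nullS N N' : N `<=` N' -> lebesgue_null N' -> lebesgue_null N.
Proof.
move=> NN' nN' e e0; have [lo [hi [h1 h2 h3]]] := nN' e e0.
by exists lo, hi; split=> //; exact: subset_trans h2.
Qed.

(** For d = 0 the empty product would give every box volume 1. *)
Lemma lebesgue_null0 : (0 < d)%N -> lebesgue_null (set0 : set 'rV[R]_d).
Proof.
move=> d0 e e0; exists (fun=> 0), (fun=> 0); split=> //.
rewrite eseries0 ?lee_fin ?ltW // => k _ _.
by rewrite (bigD1 (Ordinal d0)) //= !mxE subrr mul0r.
Qed.

Lemma lebesgue_null_bigcup (N : nat -> set 'rV[R]_d) :
  (forall k, lebesgue_null (N k)) -> lebesgue_null (\bigcup_k N k).
Proof.
move=> nN e e0.
have e2 k : 0 < e / (2 ^ k.+1)%:R by rewrite divr_gt0 // ltr0n expn_gt0.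
have [lo lohi] := @choice _ _ _ (fun k => nN k _ (e2 k)).
have [hi {}lohi] := @choice _ _ _ lohi.
have /card_esym/ppcard_eqP[h] := card_nat2.
pose vol (ij : nat * nat) : R := \prod_(l < d) (hi ij.1 ij.2 0 l - lo ij.1 ij.2 0 l).
have vol0 ij : 0 <= vol ij.
  by apply: prodr_ge0 => l _; rewrite subr_ge0; have [] := lohi ij.1.
exists (fun n => lo (h n).1 (h n).2), (fun n => hi (h n).1 (h n).2); split.
- by move=> n l; have [] := lohi (h n).1.
- move=> x [k _ Nkx]; have [_ /(_ x Nkx)[j _ xj] _] := lohi k.
  by exists (h^-1%FUN (k, j)) => //=; rewrite invK ?inE.
rewrite [leLHS](_ : _ = \sum_(0 <= n <oo) (vol (h n))%:E)%E //.
rewrite nneseries_esumT => [|n]; last by rewrite lee_fin; exact: vol0.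
rewrite -(@reindex_esum _ _ _ setT setT h (fun ij => (vol ij)%:E)) //.
rewrite (_ : [set: nat * nat] = [set: nat] `*`` (fun=> [set: nat])); last first.
  by apply/seteqP; split=> -[].
have -> : (\esum_(ij in [set: nat] `*`` (fun=> [set: nat])) (vol ij)%:E =
    \esum_(ij in [set: nat] `*`` (fun=> [set: nat])) (vol (ij.1, ij.2))%:E)%E.
  by apply: eq_esum => -[].
rewrite -(esum_esum (a := fun k l => (vol (k, l))%:E)) => [|k l _ _]; last first.
  by rewrite lee_fin.
rewrite -nneseries_esumT => [|k]; last by apply: esum_ge0 => l _; rewrite lee_fin.
apply: le_trans (epsilon_trick0 xpredT (ltW e0)).
apply: lee_nneseries => [k _ _|k _]; first by apply: esum_ge0 => l _; rewrite lee_fin.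
rewrite -nneseries_esumT => [|l]; last by rewrite lee_fin.
by have [] := lohi k.
Qed.

Lemma ess_sup_on_le D (h : 'rV[R]_d -> R) (c : R) :
  lebesgue_null (D `&` [set x | c < h x]) -> (ess_sup_on D h <= c%:E)%E.
Proof.
move=> nD; apply: ereal_inf_lbound; apply: lebesgue_nullS nD => x [Dx /= hx].
by split=> //=; rewrite ltNge; apply/negP; rewrite -lee_fin.
Qed.

(** Attainment of the infimum comes from countable unions, over the levels c + 1 / (n + 1). *)
Lemma ess_sup_on_null D (h : 'rV[R]_d -> R) (c : R) :
  (ess_sup_on D h <= c%:E)%E -> lebesgue_null (D `&` [set x | c < h x]).
Proof.
move=> hc; pose N (n : nat) := D `&` [set x | c + n.+1%:R^-1 < h x].
have nN n : lebesgue_null (N n).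
  have : (ess_sup_on D h < (c + n.+1%:R^-1)%:E)%E.
    by apply: le_lt_trans hc _; rewrite lte_fin ltrDl invr_gt0.
  move=> /ereal_inf_lt[M /= nM Mc]; apply: lebesgue_nullS nM => x [Dx /= hx].
  by split=> //= h1; have := le_lt_trans h1 Mc; rewrite lte_fin ltNge ltW.
apply: lebesgue_nullS (lebesgue_null_bigcup nN) => x [Dx /= hx].
have := hx; rewrite -subr_gt0 => hx'.
have [n] := ltr_add_invr hx; exists n => //.
Qed.

End NullSets.

Section Series.
Context {R : realType}.
Implicit Types x : nat -> R.

Lemma nneseries_partial_le x (r : R) : (forall j, 0 <= x j) ->
  (\sum_(0 <= j <oo) (x j)%:E <= r%:E)%E -> forall n, \sum_(j < n) x j <= r.
Proof.
move=> x0 hr n; rewrite -lee_fin; apply: le_trans hr.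
apply: le_trans (@nneseries_lim_ge _ _ xpredT 0 n _).
  by rewrite sumEFin lee_fin big_mkord.
by move=> k _ _; rewrite lee_fin.
Qed.

Lemma nneseries_bounded x : (forall j, 0 <= x j) ->
  (\sum_(0 <= j <oo) (x j)%:E < +oo)%E -> exists C, forall n, \sum_(j < n) x j <= C.
Proof.
move=> x0 hx; exists (fine (\sum_(0 <= j <oo) (x j)%:E)%E).
apply: nneseries_partial_le => //; rewrite fineK // ge0_fin_numE //.
by apply: nneseries_ge0 => j _ _; rewrite lee_fin.
Qed.

(** The inclusion of l^s in l^1, from x = x^s (x^s)^(rate s) with every x^s at most C. *)
Lemma bounded_sum_of_powR x (s C : R) : 0 < s < 1 -> (forall j, 0 <= x j) ->
  (forall n, \sum_(j < n) x j `^ s <= C) ->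
  exists D, forall n, \sum_(j < n) x j <= D.
Proof.
move=> /andP[s0 s1] x0 hC; have C0 : 0 <= C by have := hC 0%N; rewrite big_ord0.
have r0 : 0 < rate s by rewrite /rate subr_gt0 invf_gt1.
exists (C * C `^ rate s) => n; apply: (@le_trans _ _ (\sum_(j < n) x j `^ s * C `^ rate s)).
  apply: ler_sum => j _; have [->|xn] := eqVneq (x j) 0.
    by rewrite mulr_ge0 ?powR_ge0.
  have {1}-> : x j = x j `^ s * (x j `^ s) `^ rate s.
    rewrite -powRrM -powRD; last by rewrite xn implybT.
    rewrite -[LHS]powRr1 //; congr (_ `^ _); rewrite /rate.
    by field; rewrite gt_eqF.
  rewrite ler_wpM2l ?powR_ge0 // ge0_ler_powR ?nnegrE ?powR_ge0 ?(ltW r0) //.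
  apply: le_trans (hC j.+1); rewrite big_ord_recr /= lerDr sumr_ge0 // => i _.
  exact: powR_ge0.
by rewrite -mulr_suml ler_wpM2r ?powR_ge0.
Qed.

End Series.

(** * The parametric saddle point problem *)

Section FormDifference.
Context {R : realType} {V : normedModType R}.
Context (a a' : {bilinear V -> V -> R | *%R & *%R}).

(** The type of [a1] only records linearity in the coefficient. Since [a1] vanishes at the
    coefficient 0, it equals a(k) - a(0), and this difference carries the bilinear structure in w
    and v. *)
Definition form_sub (w v : V) : R := a w v - a' w v.

Lemma form_sub_bilinear : bilinear_for (GRing.Scale.Law.clone _ _ ( *%R ) _)
  (GRing.Scale.Law.clone _ _ ( *%R ) _) form_sub.
Proof.
have aZ (c : {bilinear V -> V -> R | *%R & *%R}) (t : R) x y z :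
    c (t *: x + y) z = t * c x z + c y z by rewrite linearDl linearZl_LR.
have aZ' (c : {bilinear V -> V -> R | *%R & *%R}) (t : R) x y z :
    c z (t *: x + y) = t * c z x + c z y by rewrite linearDr linearZr_LR.
split=> z k x y; rewrite /form_sub /=.
  by rewrite !aZ; ring.
by rewrite !aZ'; ring.
Qed.

HB.instance Definition _ := bilinear_isBilinear.Build R V V R
  (GRing.Scale.Law.clone _ _ ( *%R ) _) (GRing.Scale.Law.clone _ _ ( *%R ) _)
  form_sub form_sub_bilinear.

End FormDifference.

Lemma sq_le_bound (R : realType) (x C : R) : 0 <= C -> x ^+ 2 <= C -> x <= C + 1.
Proof.
move=> C0 xC; rewrite leNgt; apply/negP => Cx.
have : (C + 1) * (C + 1) < x * x by rewrite ltr_pM // addr_ge0.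
by move: xC; rewrite expr2; nra.
Qed.

Lemma mi_pow_ge1 (R : realType) (y : nat -> R) (nu : multi_index) :
  (forall j, 1 <= y j) -> 1 <= mi_pow y nu.
Proof.
move=> y1; rewrite /mi_pow; elim/big_rec: _ => // j x _ x1.
by rewrite mulr_ege1 // exprn_ege1.
Qed.

Lemma mi_pow_mono (R : realType) (y : nat -> R) (nu mu : multi_index) :
  (forall j, 1 <= y j) -> mi_le nu mu -> mi_pow y nu <= mi_pow y mu.
Proof.
move=> y1 numu; have [n mub] := in_mi_box mu.
rewrite (mi_pow_box _ mub) (mi_pow_box _ (mi_box_down mub numu)).
apply: ler_prod => j _; rewrite exprn_ge0 ?(le_trans ler01) //=.
by rewrite ler_weXn2l.
Qed.

Section ParametricProblem.
Context {R : realType} {d : nat} (d0 : (0 < d)%N) (D : set 'rV[R]_d).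
Context {V Q : completeNormedModType R} {K : normedModType R}.
Context (ev : K -> 'rV[R]_d -> R) (hKfun : function_space D ev).
Context (absK : K -> K) (habsK : forall k x, D x -> ev (absK k) x = `|ev k x|).
Context (a : K -> {bilinear V -> V -> R | *%R & *%R}).
Context (b : {bilinear V -> Q -> R | *%R & *%R}) (f : V -> R) (g : Q -> R).
Context (gamma alpha delta beta theta Theta C1 : R).
Hypotheses (hgamma : 0 < gamma) (halpha : 0 < alpha) (hdelta : 0 < delta).
Hypotheses (hbeta : 0 < beta) (htheta : 0 < theta) (hC1 : 0 < C1).
Hypothesis hthetaTheta : theta < Theta.
Hypothesis ha : forall k, (forall x, D x -> theta <= ev k x <= Theta) ->
  continuous_form (a k) gamma /\ coercive_on (kernel_space b) (a k) alpha.
Hypotheses (hb : continuous_form b delta) (hbinfsup : inf_sup_condition b beta).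
Context (a0 : V -> V -> R) (a1 : V -> V -> {scalar K}).
Hypothesis haff : forall k w v, a k w v = a0 w v + a1 w v k.
Hypothesis ha1_upper : forall k w v,
  ((a1 w v k)%:E <= C1%:E * ess_sup_on D (fun x => (`|ev k x|)%R) * (`|w| * `|v|)%:E)%E.
Hypothesis ha1_abs : forall k w v,
  a1 w v k <= 2^-1 * (a1 w w (absK k) + a1 v v (absK k)).
Context (kappa0 : K) (kappa : nat -> K) (kappaU : (nat -> R) -> K).
Hypothesis hkappa : forall y x, param_box y -> D x ->
  (fun n => ev kappa0 x + \sum_(0 <= j < n) y j * ev (kappa j) x) @ \oo --> ev (kappaU y) x.
Context (kmin kmax : \bar R).
Hypothesis hkmin : kmin = ereal_inf [set (ev (kappaU xy.2) xy.1)%:E | xy in D `*` param_box].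
Hypothesis hkmax : kmax = ereal_sup [set (ev (kappaU xy.2) xy.1)%:E | xy in D `*` param_box].
Hypotheses (hk1 : (theta%:E < kmin)%E) (hk2 : (kmax < (Theta / 2)%:E)%E).
Context (u : (nat -> R) -> V) (p : (nat -> R) -> Q).
Hypothesis hup : forall y, param_box y ->
  saddle_point_solution (a (kappaU y)) b f g (u y) (p y).

Let A (y : nat -> R) : {bilinear V -> V -> R | *%R & *%R} := a (kappaU y).
Let form (k : K) : {bilinear V -> V -> R | *%R & *%R} := form_sub (a k) (a 0).
Let B j := form (kappa j).
Let Bab j := form (absK (kappa j)).
Let A0 := A (fun=> 0).
Let T := taylor_coef u.
Let P := taylor_coef p.
Implicit Types (nu mu : multi_index) (y : nat -> R).

Let formE k w v : form k w v = a1 w v k.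
Proof. by rewrite /form /= /form_sub !haff linear0; ring. Qed.

Let Theta0 : 0 < Theta. Proof. exact: lt_trans hthetaTheta. Qed.

Let evP x k k' (c : R) : D x -> ev (c *: k + k') x = c * ev k x + ev k' x.
Proof. by case: hKfun => h _ _ Dx; rewrite (h x Dx). Qed.

Let ev0 x : D x -> ev 0 x = 0.
Proof. by move=> Dx; have := evP 0 0 (-1) Dx; rewrite scaler0 addr0 mulN1r addNr. Qed.

Let evD x k k' : D x -> ev (k + k') x = ev k x + ev k' x.
Proof. by move=> Dx; have := evP k k' 1 Dx; rewrite scale1r mul1r. Qed.

Let evZ x k (c : R) : D x -> ev (c *: k) x = c * ev k x.
Proof. by move=> Dx; rewrite -[c *: k]addr0 evP // ev0 // addr0. Qed.

Let ev_sum x n (F : nat -> K) : D x -> ev (\sum_(j < n) F j) x = \sum_(j < n) ev (F j) x.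
Proof.
move=> Dx; elim: n => [|n IH]; first by rewrite !big_ord0 ev0.
by rewrite !big_ord_recr /= evD // IH.
Qed.

Let ev_inj k k' : (forall x, D x -> ev k x = ev k' x) -> k = k'.
Proof.
move=> kk'; case: hKfun => _ h _; apply/eqP; rewrite -subr_eq0; apply/eqP; apply: h => x Dx.
by rewrite -scaleN1r evD // evZ // kk' // mulN1r subrr.
Qed.

Let form_bound k (c : R) : 0 <= c -> lebesgue_null (D `&` [set x | c < `|ev k x|]) ->
  forall w v, form k w v <= C1 * c * `|w| * `|v|.
Proof.
move=> c0 nk w v; rewrite formE -mulrA -lee_fin; apply: (le_trans (ha1_upper _ _ _)).
rewrite [X in (_ <= X)%E]EFinM lee_wpmul2r ?lee_fin ?mulr_ge0 //.
by rewrite EFinM lee_wpmul2l ?lee_fin ?(ltW hC1) // ess_sup_on_le.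
Qed.

Let form_bound_sup k (c : R) : 0 <= c -> (forall x, D x -> `|ev k x| <= c) ->
  forall w v, form k w v <= C1 * c * `|w| * `|v|.
Proof.
move=> c0 kc; apply: form_bound => //; apply: lebesgue_nullS (@lebesgue_null0 R d d0).
by move=> x [Dx /=]; rewrite ltNge kc.
Qed.

(** * The parametric coefficient and its bounds *)

Let kU_lim y x (l : R) n : param_box y -> D x ->
  (forall m, (n <= m)%N -> ev kappa0 x + \sum_(j < m) y j * ev (kappa j) x = l) ->
  ev (kappaU y) x = l.
Proof.
move=> yb Dx hl; have := hkappa yb Dx => h.
have : (fun m => ev kappa0 x + \sum_(0 <= j < m) y j * ev (kappa j) x) @ \oo --> l.
  apply: cvg_near_cst; exists n => // m /= nm; rewrite big_mkord; exact: hl.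
by move=> h'; exact: (cvg_unique (@norm_hausdorff _ R) h h').
Qed.

Let box0 : param_box (fun=> 0 : R).
Proof. by move=> j /=; rewrite lerN10 ler01. Qed.

Let kU0 : kappaU (fun=> 0) = kappa0.
Proof.
apply: ev_inj => x Dx; apply: (@kU_lim _ _ _ 0) => // m _.
by rewrite big1 ?addr0 // => j _; rewrite mul0r.
Qed.

Let kU_range y x : param_box y -> D x -> (theta < ev (kappaU y) x) /\ ev (kappaU y) x < Theta / 2.
Proof.
move=> yb Dx; split; rewrite -lte_fin.
  apply: lt_le_trans hk1 _; rewrite hkmin; apply: ereal_inf_lbound.
  by exists (x, y).
apply: le_lt_trans hk2; rewrite hkmax; apply: ereal_sup_ubound.
by exists (x, y).
Qed.

Let A_good y : param_box y ->
  continuous_form (A y) gamma /\ coercive_on (kernel_space b) (A y) alpha.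
Proof.
move=> yb; apply: ha => x Dx; have [h1 h2] := kU_range yb Dx.
by rewrite ltW //= ltW // (lt_trans h2) // ltr_pdivrMr // ltr_pMr // ltr1n.
Qed.

(** The identity holds for the partial sums containing the term j, passes to the pointwise limits,
    and then to K because its elements are determined by their values on D. *)
Let kU_with y j (t : R) : param_box y -> param_box [eta y with j |-> t] ->
  kappaU [eta y with j |-> t] = kappaU y + (t - y j) *: kappa j.
Proof.
move=> yb tb; apply: ev_inj => x Dx; rewrite evD // evZ //.
have h := hkappa yb Dx; have h' := hkappa tb Dx.
apply: (cvg_unique (@norm_hausdorff _ R) h').
have : (fun m => ev kappa0 x + \sum_(0 <= i < m) y i * ev (kappa i) x +
    (t - y j) * ev (kappa j) x) @ \oo --> ev (kappaU y) x + (t - y j) * ev (kappa j) x.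
  by apply: cvgD => //; exact: cvg_cst.
apply: cvg_trans; apply: near_eq_cvg; exists j.+1 => // m /= jm.
rewrite -addrA; congr (_ + _); rewrite !big_mkord (bigD1 (Ordinal jm)) //=.
rewrite [RHS](bigD1 (Ordinal jm)) //= eqxx.
rewrite [X in _ = _ + X](eq_bigr (fun i : 'I_m => y i * ev (kappa i) x)); first by ring.
by move=> i ij; rewrite (_ : (i == j :> nat) = false) //; apply: negbTE.
Qed.

Let open_box_param y : open_box y -> param_box y.
Proof. by move=> yo j; rewrite -ler_norml ltW. Qed.

Let A_with y j (t : R) : open_box y -> open_box [eta y with j |-> t] ->
  forall w v, A [eta y with j |-> t] w v = A y w v + (t - y j) * B j w v.
Proof.
move=> yo to w v; rewrite /A kU_with; [|exact: open_box_param..].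
by rewrite !haff linearD linearZ /= /B formE; ring.
Qed.

(** The parameter depends on x: with y_j = - sgn kappa_j(x) for j < n and 0 beyond, the coefficient
    at x equals the difference of kappa_0(x) and the sum, and it exceeds theta. *)
Let sum_abs_kappa x n : D x -> \sum_(j < n) `|ev (kappa j) x| <= ev kappa0 x - theta.
Proof.
move=> Dx; pose y j : R := if (j < n)%N then - Num.sg (ev (kappa j) x) else 0.
have yb : param_box y.
  move=> j; rewrite /y; case: ifP => _; last exact: box0.
  by rewrite -ler_norml normrN normr_sg; case: (_ != 0).
have [h _] := kU_range yb Dx.
suff E : ev (kappaU y) x = ev kappa0 x - \sum_(j < n) `|ev (kappa j) x|.
  by move: h; rewrite E; lra.
apply: (@kU_lim _ _ _ n) => // m nm; congr (_ + _).
rewrite (big_ord_widen m (fun j => `|ev (kappa j) x|) nm) -sumrN [RHS]big_mkcond.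
apply: eq_bigr => j _; rewrite /y; case: ifP => _; last by rewrite mul0r.
by rewrite mulNr normrEsg.
Qed.

Let kappa0_range x : D x -> theta < ev kappa0 x < Theta / 2.
Proof. by move=> Dx; have [h1 h2] := kU_range box0 Dx; rewrite kU0 in h1 h2; rewrite h1. Qed.

Let kappa_bound j x : D x -> `|ev (kappa j) x| <= Theta / 2.
Proof.
move=> Dx; have := sum_abs_kappa j.+1 Dx; rewrite big_ord_recr /=.
have : 0 <= \sum_(i < j) `|ev (kappa i) x| by exact: sumr_ge0.
by have /andP[_] := kappa0_range Dx; move: htheta; lra.
Qed.

Let Theta2 : 0 <= Theta / 2. Proof. by rewrite divr_ge0 // ltW. Qed.

Let B_bound j : continuous_form (B j) (C1 * (Theta / 2)).
Proof. by move=> w v; apply: form_bound_sup => // x Dx; exact: kappa_bound. Qed.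

Let rec0 : saddle_point_solution A0 b f g (T mi0) (P mi0).
Proof. by apply: (@taylor_coef0 _ _ _ A) => y /open_box_param/hup. Qed.

Let rec n nu : nu \in mi_box n -> nu != mi0 ->
  (forall v, A0 (T nu) v + b v (P nu) =
    - \sum_(j < n | (0 < nu j)%N) B j (T (mi_pred nu j)) v) /\
  (forall q, b (T nu) q = 0).
Proof.
apply: (@taylor_coef_rec R V Q A B b f g u p alpha gamma beta delta (C1 * (Theta / 2))) => //.
- exact: ltW.
- exact: ltW.
- by rewrite mulr_ge0 // ltW.
- by move=> y /open_box_param/A_good.
- by move=> y /open_box_param/hup.
Qed.

Let B_abs j w v : B j w v <= 2^-1 * (Bab j w w + Bab j v v).
Proof. by rewrite /B /Bab !formE. Qed.

(* The second condition is coercivity at kappa_0 - sum_(j < n) rho_j |kappa_j|. *)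
Definition admissible (rho : nat -> R) (al M : R) :=
  [/\ forall j, 0 <= rho j,
      forall n v, kernel_space b v ->
        al * `|v| ^+ 2 + \sum_(j < n) rho j * Bab j v v <= A0 v v &
      forall n v, \sum_(j < n) rho j * Bab j v v <= M * `|v| ^+ 2].

Let sum_Bab (rho : nat -> R) n v :
  \sum_(j < n) rho j * Bab j v v = form (\sum_(j < n) rho j *: absK (kappa j)) v v.
Proof.
by rewrite formE linear_sum; apply: eq_bigr => j _; rewrite /Bab formE linearZ.
Qed.

Let ev_sum_abs (rho : nat -> R) n x : D x ->
  ev (\sum_(j < n) rho j *: absK (kappa j)) x = \sum_(j < n) rho j * `|ev (kappa j) x|.
Proof. by move=> Dx; rewrite (ev_sum n (fun j => rho j *: absK (kappa j)) Dx); apply: eq_bigr => j _; rewrite evZ // habsK. Qed.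

(** The coefficient kappa_0 - sum_j rho_j |kappa_j| lies between theta and Theta, so coercivity
    holds there, and linearity in the coefficient moves the sum to the other side. The constant M
    comes from kappa_0 - theta <= Theta / 2. *)
Let admissible_sum (rho : nat -> R) : (forall j, 0 <= rho j) ->
  (forall n x, D x -> \sum_(j < n) rho j * `|ev (kappa j) x| <= ev kappa0 x - theta) ->
  admissible rho alpha (C1 * (Theta / 2)).
Proof.
move=> rho0 h; split=> // n v; last first.
  rewrite sum_Bab expr2 [leRHS]mulrA; apply: form_bound_sup => // x Dx.
  rewrite ev_sum_abs // ger0_norm ?sumr_ge0 // => [|j _]; last by rewrite mulr_ge0.
  by apply: le_trans (h n x Dx) _; have /andP[_] := kappa0_range Dx; move: htheta; lra.
move=> kv; pose k := kappa0 + (-1) *: \sum_(j < n) rho j *: absK (kappa j).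
have [|_ /(_ v kv)] := ha (k := k).
  move=> x Dx; rewrite /k evD // evZ // ev_sum_abs // mulN1r.
  have := h n x Dx; have /andP[h1 h2] := kappa0_range Dx.
  have : 0 <= \sum_(j < n) rho j * `|ev (kappa j) x|.
    by apply: sumr_ge0 => j _; rewrite mulr_ge0.
  by move=> h3 h4; move: Theta0 => h5; apply/andP; split; lra.
rewrite sum_Bab formE /A0 /A kU0 !haff /k linearD linearZ /= mulN1r.
lra.
Qed.

Let admissible1 : admissible (fun=> 1) alpha (C1 * (Theta / 2)).
Proof.
apply: admissible_sum => // n x Dx; under eq_bigr do rewrite mul1r.
exact: sum_abs_kappa.
Qed.

(** The excess rho_j - 1 is paid for out of the coercivity at rho = 1: its total contribution is at
    most C1 eta |v|^2, thus at most half of alpha |v|^2. *)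
Let admissible_perturb (rho bq : nat -> R) (eta : R) : (forall j, 0 <= bq j) ->
  (forall j, lebesgue_null (D `&` [set x | bq j < `|ev (kappa j) x|])) ->
  (forall j, 1 <= rho j) -> (forall n, \sum_(j < n) (rho j - 1) * bq j <= eta) ->
  C1 * eta <= alpha / 2 ->
  admissible rho (alpha / 2) (C1 * (Theta / 2) + alpha / 2).
Proof.
move=> bq0 nbq rho1 hrho heta.
have pert n v : \sum_(j < n) (rho j - 1) * Bab j v v <= alpha / 2 * `|v| ^+ 2.
  apply: (@le_trans _ _ (\sum_(j < n) (rho j - 1) * bq j * (C1 * `|v| ^+ 2))).
    apply: ler_sum => j _; rewrite -mulrA ler_wpM2l ?subr_ge0 //.
    have -> : bq j * (C1 * `|v| ^+ 2) = C1 * bq j * `|v| * `|v| by ring.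
    apply: form_bound => //; apply: lebesgue_nullS (nbq j) => x [Dx /=].
    by rewrite habsK // normr_id.
  rewrite -mulr_suml mulrA ler_wpM2r ?exprn_ge0 //; apply: le_trans heta.
  by rewrite mulrC ler_wpM2l // ltW.
have splt n v : \sum_(j < n) rho j * Bab j v v =
    \sum_(j < n) 1 * Bab j v v + \sum_(j < n) (rho j - 1) * Bab j v v.
  by rewrite -big_split /=; apply: eq_bigr => j _; ring.
have [_ h1 h2] := admissible1.
split=> [j|n v kv|n v]; first by rewrite (le_trans _ (rho1 j)).
  by rewrite splt; have := h1 n v kv; have := pert n v; lra.
by rewrite splt mulrDl lerD.
Qed.

(** The constant is chosen before rho, so that a family of weights, one for each nu, can share
    it. *)
Let coef_sq_sum (al M : R) : 0 < al -> 0 <= M -> exists2 c, 0 <= c &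
  forall rho, admissible rho al M -> forall n,
    \sum_(nu <- mi_box n) (mi_pow rho nu * `|T nu|) ^+ 2 <= c /\
    \sum_(nu <- mi_box n) (mi_pow rho nu * `|P nu|) ^+ 2 <= c.
Proof.
move=> al0 M0; pose cu := `|T mi0| ^+ 2 * (1 + M / (2 * al)).
pose cp := `|P mi0| ^+ 2 + (M + 1) * (M + gamma ^+ 2) / beta ^+ 2 * cu.
have cu0 : 0 <= cu by rewrite mulr_ge0 ?exprn_ge0 // addr_ge0 // divr_ge0 // mulr_ge0 // ltW.
have cp0 : 0 <= cp.
  rewrite addr_ge0 ?exprn_ge0 // mulr_ge0 // divr_ge0 ?exprn_ge0 ?(ltW hbeta) //.
  by rewrite mulr_ge0 ?addr_ge0 // exprn_ge0 // ltW.
exists (cu + cp) => [|rho [rho0 h1 h2] n]; first by rewrite addr_ge0.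
have Ac := (A_good box0).1; split.
  apply: (@le_trans _ _ cu); last by rewrite lerDl.
  exact: (@energy_u R V Q A0 B Bab b T P al M rho al0 B_abs rec rho0 h1 h2 n).
apply: (@le_trans _ _ cp); last by rewrite lerDr.
exact: (@energy_p R V Q A0 B Bab b T P al gamma beta M rho al0 (ltW hgamma) hbeta M0 Ac
  hbinfsup B_abs rec rho0 h1 h2 n).
Qed.
Let largest_sets :
  (exists L, largest_index_sets (fun nu => `|T nu|) L) /\
  (exists L, largest_index_sets (fun nu => `|P nu|) L).
Proof.
have [c _ /(_ _ admissible1) h] := coef_sq_sum halpha (mulr_ge0 (ltW hC1) Theta2).
have one nu : mi_pow (fun=> 1 : R) nu = 1.
  by rewrite /mi_pow big1 // => j _; rewrite expr1n.
split; apply: largest_index_sets_ex => //; apply: (sq_sum_decay (C := c)) => n.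
    rewrite (eq_bigr (fun nu => (mi_pow (fun=> 1) nu * `|T nu|) ^+ 2)); first exact: (h n).1.
  by move=> nu _; rewrite one mul1r.
rewrite (eq_bigr (fun nu => (mi_pow (fun=> 1) nu * `|P nu|) ^+ 2)); first exact: (h n).2.
by move=> nu _; rewrite one mul1r.
Qed.

(** A single term of the weighted sum gives rho^mu |T mu| <= c + 1, and rho >= 1 allows rho^mu to be
    replaced by rho^nu. *)
Let majorant (al M : R) : 0 < al -> 0 <= M -> exists2 c, 0 <= c &
  forall rho, admissible rho al M -> (forall j, 1 <= rho j) ->
  forall nu mu, mi_le nu mu ->
    `|T mu| <= c * (mi_pow rho nu)^-1 /\ `|P mu| <= c * (mi_pow rho nu)^-1.
Proof.
move=> al0 M0; have [c c0 hc] := coef_sq_sum al0 M0.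
exists (c + 1) => [|rho arho rho1 nu mu numu]; first exact: addr_ge0.
have [n mun] := in_mi_box mu; have [h1 h2] := hc rho arho n.
have pge1 m := mi_pow_ge1 m rho1.
have pgt0 m : 0 < mi_pow rho m by apply: lt_le_trans (pge1 m).
have key (F : multi_index -> R) : (forall m, 0 <= F m) ->
    \sum_(m <- mi_box n) (mi_pow rho m * F m) ^+ 2 <= c -> F mu <= (c + 1) * (mi_pow rho nu)^-1.
  move=> F0; rewrite (big_rem _ mun) /= => h.
  have : (mi_pow rho mu * F mu) ^+ 2 <= c.
    by apply: le_trans h; rewrite lerDl sumr_ge0 // => m _; exact: sqr_ge0.
  move=> /(sq_le_bound c0); rewrite mulrC -ler_pdivlMr // => /le_trans; apply.
  by rewrite ler_wpM2l ?addr_ge0 // lef_pV2 ?posrE // mi_pow_mono.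
by split; apply: (key (fun m => `|_ m|)).
Qed.

(** The remainder of the affine form beyond n variables is the form of a coefficient bounded by the
    tail of [bq] outside the union of the countably many exceptional null sets. *)
Let converge (bq : nat -> R) (Bs Ts : R) : (forall j, 0 <= bq j) ->
  (forall j, lebesgue_null (D `&` [set x | bq j < `|ev (kappa j) x|])) ->
  (forall n, \sum_(j < n) bq j <= Bs) ->
  (forall n, \sum_(nu <- mi_box n) `|T nu| <= Ts) ->
  forall y, param_box y -> forall e : R, 0 < e -> exists m0, forall m, (m0 <= m)%N ->
    `|u y - taylor_sum u (mi_box m) y| <= e /\ `|p y - taylor_sum p (mi_box m) y| <= e.
Proof.
move=> bq0 nbq hBs hTs y yb e e0; have [Ac Aco] := A_good yb.
apply: (@taylor_converges R V Q A0 (A y) B b f g T P y (u y) (p y) alpha gamma beta Ts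
  (C1 * Bs) (fun j => C1 * bq j)) => //.
- exact: ltW.
- exact: hup.
- by move=> j w v; exact: form_bound.
- by move=> j; rewrite mulr_ge0 // ltW.
- by move=> n; rewrite -mulr_sumr ler_wpM2l // ltW.
move=> {e0}e e0; have e1 : 0 < e / C1 by rewrite divr_gt0.
have [J hJ] := sum_tail bq0 hBs e1; exists J => n Jn w v.
pose k := kappaU y + (-1) *: (kappa0 + \sum_(j < n) y j *: kappa j).
have -> : A y w v - A0 w v - \sum_(j < n) y j * B j w v = form k w v.
  have -> : \sum_(j < n) y j * B j w v = a1 w v (\sum_(j < n) y j *: kappa j).
    by rewrite linear_sum; apply: eq_bigr => j _; rewrite linearZ /= /B formE.
  rewrite formE /k /A0 /A kU0 !haff [in RHS]linearD linearZ /= [a1 w v (kappa0 + _)]linearD.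
  ring.
have -> : e = C1 * (e / C1) by field; rewrite gt_eqF.
apply: continuous_form_norm => {}w {}v; apply: form_bound; first exact: ltW.
apply: lebesgue_nullS (lebesgue_null_bigcup nbq) => x [Dx /= hx].
apply: contrapT => no; have bx j : `|ev (kappa j) x| <= bq j.
  by rewrite leNgt; apply/negP => hj; apply: no; exists j.
suff : `|ev k x| <= e / C1 by rewrite leNgt hx.
have evk : ev k x = ev (kappaU y) x - (ev kappa0 x + \sum_(j < n) y j * ev (kappa j) x).
  rewrite /k evD // evZ // mulN1r evD // (ev_sum n (fun j => y j *: kappa j)) //.
  by congr (_ - (_ + _)); apply: eq_bigr => j _; rewrite evZ.
apply/ler_addgt0Pl => eps eps0.
have /cvgrPdist_le/(_ eps eps0)[m0 _ hm0] := hkappa yb Dx.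
pose m := maxn m0 n; have := hm0 m (leq_maxl _ _); rewrite /= big_mkord => hm.
rewrite evk; pose Sm := ev kappa0 x + \sum_(j < m) y j * ev (kappa j) x.
rewrite -(subrKA Sm); apply: (le_trans (ler_normD _ _)); apply: lerD => //.
have -> : Sm - (ev kappa0 x + \sum_(j < n) y j * ev (kappa j) x) =
    \sum_(j < m | (n <= j)%N) y j * ev (kappa j) x.
  rewrite /Sm (bigID (fun j : 'I_m => (j < n)%N)) /=.
  rewrite -(big_ord_widen m (fun j => y j * ev (kappa j) x) (leq_maxr _ _)).
  under [X in _ + (_ + X) - _]eq_bigl do rewrite -leqNgt.
  by ring.
apply: (le_trans (ler_norm_sum _ _ _)); apply: le_trans (hJ m).
rewrite big_mkcond [leRHS]big_mkcond; apply: ler_sum => j _.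
case: ifP => nj; last by case: ifP.
rewrite (leq_trans Jn nj) normrM -[leRHS]mul1r ler_pM // ler_norml; exact: yb.
Qed.

(** * Convergence rates in the two cases *)

Let tu nu := `|T nu|.
Let tp nu := `|P nu|.

(** Common end of both cases. As 0 <= q <= 1 and s < 1, q <= q^s, so the norms of T are summable,
    which convergence of the Taylor series requires. *)
Let case_conclusion (s c C Bs : R) (q : multi_index -> R) (bq : nat -> R) Lu Lp :
  0 < s < 1 -> 0 <= c -> (forall nu, 0 <= q nu <= 1) ->
  (forall nu mu, mi_le nu mu -> `|T mu| <= c * q nu /\ `|P mu| <= c * q nu) ->
  (forall n, \sum_(nu <- mi_box n) q nu `^ s <= C) ->
  (forall j, 0 <= bq j) ->
  (forall j, lebesgue_null (D `&` [set x | bq j < `|ev (kappa j) x|])) ->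
  (forall n, \sum_(j < n) bq j <= Bs) ->
  largest_index_sets tu Lu ->
  largest_index_sets tp Lp ->
  [/\ (lm_norm s tu < +oo)%E, (lm_norm s tp < +oo)%E &
    forall N, (1 <= N)%N ->
      (taylor_error u (Lu N) <=
        lm_norm s tu * (N%:R `^ (- rate s))%:E)%E /\
      (taylor_error p (Lp N) <=
        lm_norm s tp * (N%:R `^ (- rate s))%:E)%E].
Proof.
move=> s01 c0 q01 TP hC bq0 nbq hBs hLu hLp; have /andP[s0 s1] := s01.
have q0 nu : 0 <= q nu by case/andP: (q01 nu).
have [lu au] := @majorized_envelope R (fun nu => `|T nu|) q s c C Lu (fun=> normr_ge0 _) c0 q0
  (fun nu mu h => (TP nu mu h).1) s01 hC hLu.
have [lp ap] := @majorized_envelope R (fun nu => `|P nu|) q s c C Lp (fun=> normr_ge0 _) c0 q0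
  (fun nu mu h => (TP nu mu h).2) s01 hC hLp.
have hT n : \sum_(nu <- mi_box n) `|T nu| <= c * C.
  apply: (@le_trans _ _ (\sum_(nu <- mi_box n) c * q nu `^ s)).
    apply: ler_sum => nu _; apply: le_trans (TP nu nu (fun j => leqnn _)).1 _.
    rewrite ler_wpM2l //; have [->|qn] := eqVneq (q nu) 0; first exact: powR_ge0.
    rewrite -{1}[q nu]powRr1 //; apply: ger_powR; last exact: ltW.
    by rewrite lt_neqAle eq_sym qn q0 /=; case/andP: (q01 nu).
  by rewrite -mulr_sumr ler_wpM2l.
have conv := converge bq0 nbq hBs hT.
split=> // N N1; have [ru [<- hu]] := au N N1; have [rp [<- hp]] := ap N N1.
split; apply: taylor_error_le => // y yb e e0; have [m0 hm] := conv y yb e e0.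
  by exists m0 => m /hm[].
by exists m0 => m /hm[].
Qed.

Let case_i (s : R) Lu Lp : largest_index_sets tu Lu -> largest_index_sets tp Lp ->
  0 < s < 1 -> (\sum_(0 <= j <oo) (`|kappa j| `^ s)%:E < +oo)%E ->
  [/\ (lm_norm s tu < +oo)%E, (lm_norm s tp < +oo)%E &
    forall N, (1 <= N)%N ->
      (taylor_error u (Lu N) <= lm_norm s tu * (N%:R `^ (- rate s))%:E)%E /\
      (taylor_error p (Lp N) <= lm_norm s tp * (N%:R `^ (- rate s))%:E)%E].
Proof.
move=> hLu hLp s01 hs; have [_ _ [Ck hCk]] := hKfun.
have [C hC] := nneseries_bounded (fun j => powR_ge0 `|kappa j| s) hs.
(* The sign of the embedding constant is not prescribed, hence its absolute value. *)
pose bq j := `|Ck| * `|kappa j|; have bq0 j : 0 <= bq j by rewrite mulr_ge0.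
have nbq j : lebesgue_null (D `&` [set x | bq j < `|ev (kappa j) x|]).
  apply: ess_sup_on_null; apply: le_trans (hCk _) _.
  by rewrite lee_fin ler_wpM2r // ler_norm.
have bqC n : \sum_(j < n) bq j `^ s <= `|Ck| `^ s * C.
  under eq_bigr do rewrite powRM //.
  by rewrite -mulr_sumr; apply: ler_wpM2l; [exact: powR_ge0|exact: hC].
have [Bs hBs] := bounded_sum_of_powR s01 bq0 bqC.
(* The largest budget allowed by [admissible_perturb]: C1 eta = alpha / 2. *)
pose eta := alpha / 2 / C1.
have eta0 : 0 < eta by rewrite !divr_gt0.
have [rho [Dq [rho1 hrho hDq]]] := adaptive_weights bq0 s01 eta0 bqC.
have M0 : 0 <= C1 * (Theta / 2) + alpha / 2.
  by apply: addr_ge0; [exact: mulr_ge0 (ltW hC1) Theta2|rewrite divr_ge0 // ltW].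
have [c c0 hc] := majorant (divr_gt0 halpha (ltr0Sn _ 1)) M0.
have adm nu : admissible (rho nu) (alpha / 2) (C1 * (Theta / 2) + alpha / 2).
  apply: (admissible_perturb bq0 nbq (rho1 nu) (hrho nu)).
  by rewrite /eta mulrC divfK // gt_eqF.
apply: (@case_conclusion s c Dq Bs (fun nu => (mi_pow (rho nu) nu)^-1) bq) => //.
- move=> nu; have h := mi_pow_ge1 nu (rho1 nu).
  by rewrite invr_ge0 (le_trans _ h) //= invf_le1 // (lt_le_trans _ h).
- by move=> nu mu; exact: hc.
Qed.

Let case_ii (rho : nat -> R) (eps t : R) Lu Lp :
  largest_index_sets tu Lu -> largest_index_sets tp Lp ->
  (forall j, 1 < rho j) ->
  (forall x, D x -> (\sum_(0 <= j <oo) (rho j * `|ev (kappa j) x|)%:E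
     <= (ev kappa0 x - eps)%:E)%E) ->
  theta < eps -> 0 < t < 1 -> (\sum_(0 <= j <oo) ((rho j)^-1 `^ t)%:E < +oo)%E ->
  [/\ (lm_norm t tu < +oo)%E, (lm_norm t tp < +oo)%E &
    forall N, (1 <= N)%N ->
      (taylor_error u (Lu N) <= lm_norm t tu * (N%:R `^ (- rate t))%:E)%E /\
      (taylor_error p (Lp N) <= lm_norm t tp * (N%:R `^ (- rate t))%:E)%E].
Proof.
move=> hLu hLp rho1 hsum heps t01 ht; have /andP[t0 t1] := t01.
have rho0 j : 0 < rho j by apply: lt_trans (rho1 j).
have ri0 j : 0 <= (rho j)^-1 by rewrite invr_ge0 ltW.
have psum n x : D x -> \sum_(j < n) rho j * `|ev (kappa j) x| <= ev kappa0 x - eps.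
  move=> Dx; apply: (nneseries_partial_le _ (hsum x Dx)) => j.
  by rewrite mulr_ge0 // ltW.
have adm : admissible rho alpha (C1 * (Theta / 2)).
  apply: admissible_sum => [j|n x Dx]; first exact: ltW.
  by apply: le_trans (psum n x Dx) _; rewrite lerD2l lerN2 ltW.
have [c c0 hc] := majorant halpha (mulr_ge0 (ltW hC1) Theta2).
have [C hC] := nneseries_bounded (fun j => powR_ge0 (rho j)^-1 t) ht.
have [Bs hBs] := bounded_sum_of_powR t01 ri0 hC.
pose x j := (rho j)^-1 `^ t.
have x01 j : 0 <= x j < 1.
  rewrite powR_ge0 /= (_ : 1 = 1 `^ t); last by rewrite powR1.
  by apply: gt0_ltr_powR; rewrite ?nnegrE // invf_lt1.
have [Dq hDq] := prod_geometric_bounded x01 hC.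
(* Pointwise, rho_j |kappa_j| <= kappa_0 - eps <= Theta / 2; these bounds are summable because the
   rho_j^-1 are. *)
pose bq j := Theta / 2 * (rho j)^-1.
apply: (@case_conclusion t c Dq (Theta / 2 * Bs) (fun nu => (mi_pow rho nu)^-1) bq) => //.
- move=> nu; have h := mi_pow_ge1 nu (fun j => ltW (rho1 j)).
  by rewrite invr_ge0 (le_trans _ h) //= invf_le1 // (lt_le_trans _ h).
- by move=> nu mu; exact: hc adm (fun j => ltW (rho1 j)) nu mu.
- move=> n; apply: le_trans (hDq n).
  rewrite -(sum_box_prod (fun j k => x j ^+ k)) le_eqVlt; apply/predU1P; left.
  apply: eq_big_seq => nu nub; rewrite (mi_pow_box _ nub) -prodfV powR_prod => [|j].
    by apply: eq_bigr => j _; rewrite -exprVn powRX.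
  by rewrite invr_ge0 exprn_ge0 // ltW.
- by move=> j; rewrite mulr_ge0.
- move=> j; apply: lebesgue_nullS (@lebesgue_null0 R d d0) => z [Dz /=].
  rewrite ltNge => /negP; apply; rewrite ler_pdivlMr // mulrC.
  have := psum j.+1 z Dz; rewrite big_ord_recr /=.
  have : 0 <= \sum_(i < j) rho i * `|ev (kappa i) z|.
    by apply: sumr_ge0 => i _; rewrite mulr_ge0 // ltW.
  by have /andP[_] := kappa0_range Dz; move: htheta heps; lra.
- by move=> n; rewrite -mulr_sumr; apply: ler_wpM2l.
Qed.

(** The index sets are fixed before s, rho, eps and t, so the same sets serve both cases and all
    exponents. *)
Lemma best_N_term_rates : exists Lu Lp : nat -> {fset multi_index},
  [/\ largest_index_sets tu Lu,
      largest_index_sets tp Lp,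
      (forall s : R, 0 < s < 1 ->
         (\sum_(0 <= j <oo) (`|kappa j| `^ s)%:E < +oo)%E ->
         [/\ (lm_norm s tu < +oo)%E, (lm_norm s tp < +oo)%E &
             forall N, (1 <= N)%N ->
               (taylor_error u (Lu N)
                  <= lm_norm s tu * (N%:R `^ (- rate s))%:E)%E /\
               (taylor_error p (Lp N)
                  <= lm_norm s tp * (N%:R `^ (- rate s))%:E)%E]) &
      (forall (rho : nat -> R) (eps t : R),
         (forall j, 1 < rho j) ->
         (forall x, D x ->
            (\sum_(0 <= j <oo) (rho j * `|ev (kappa j) x|)%:E
               <= (ev kappa0 x - eps)%:E)%E) ->
         theta < eps -> (eps%:E < kmin)%E ->
         0 < t ->
         (\sum_(0 <= j <oo) ((rho j)^-1 `^ t)%:E < +oo)%E ->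
         t < 1 ->
         [/\ (lm_norm t tu < +oo)%E, (lm_norm t tp < +oo)%E &
             forall N, (1 <= N)%N ->
               (taylor_error u (Lu N)
                  <= lm_norm t tu * (N%:R `^ (- rate t))%:E)%E /\
               (taylor_error p (Lp N)
                  <= lm_norm t tp * (N%:R `^ (- rate t))%:E)%E])].
Proof.
have [[Lu hLu] [Lp hLp]] := largest_sets; exists Lu, Lp; split=> // [s|rho eps t].
  exact: case_i.
move=> rho1 hsum heps _ t0 ht t1; apply: (@case_ii rho eps t) => //.
by rewrite t0.
Qed.

End ParametricProblem.

Theorem theorem3p8
  (R : realType)
  (d : nat) (hd : d = 2%N \/ d = 3%N)
  (D : set 'rV[R]_d) (hDopen : open D) (hDbounded : bounded_set D)
  (hDlip : lipschitz_boundary D)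
  (V Q : completeNormedModType R) (hV : hilbert_norm V) (hQ : hilbert_norm Q)
  (K : completeNormedModType R) (hKsep : separable_space K)
  (ev : K -> 'rV[R]_d -> R) (hKfun : function_space D ev)
  (absK : K -> K) (habsK : forall k x, D x -> ev (absK k) x = `|ev k x|)
  (a : K -> {bilinear V -> V -> R | *%R & *%R})
  (b : {bilinear V -> Q -> R | *%R & *%R})
  (f : {scalar V}) (hf : continuous f) (g : {scalar Q}) (hg : continuous g)
  (gamma alpha delta beta theta Theta : R)
  (hgamma : 0 < gamma) (halpha : 0 < alpha) (hdelta : 0 < delta)
  (hbeta : 0 < beta) (htheta : 0 < theta) (hthetaTheta : theta < Theta)
  (ha : forall k, (forall x, D x -> theta <= ev k x <= Theta) ->
     continuous_form (a k) gamma /\ coercive_on (kernel_space b) (a k) alpha)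
  (hb : continuous_form b delta) (hbinfsup : inf_sup_condition b beta)
  (a0 : V -> V -> R) (a1 : V -> V -> {scalar K})
  (haff : forall k w v, a k w v = a0 w v + a1 w v k)
  (c1 C1 : R) (hc1 : 0 < c1) (hC1 : 0 < C1)
  (ha1_lower : forall k v, (forall x, D x -> 0 <= ev k x) ->
     kernel_space b v ->
     (c1%:E * ess_inf_on D (fun x => (`|ev k x|)%R) * (`|v| ^+ 2)%:E
        <= (a1 v v k)%:E)%E)
  (ha1_upper : forall k w v,
     ((a1 w v k)%:E
        <= C1%:E * ess_sup_on D (fun x => (`|ev k x|)%R) * (`|w| * `|v|)%:E)%E)
  (ha1_abs : forall k w v,
     a1 w v k <= 2^-1 * (a1 w w (absK k) + a1 v v (absK k)))
  (kappa0 : K) (kappa : nat -> K) (kappaU : (nat -> R) -> K)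
  (hkappa : forall y x, param_box y -> D x ->
     (fun n => ev kappa0 x + \sum_(0 <= j < n) y j * ev (kappa j) x)
       @ \oo --> ev (kappaU y) x)
  (kmin kmax : \bar R)
  (hkmin : kmin = ereal_inf [set (ev (kappaU xy.2) xy.1)%:E
                            | xy in D `*` param_box])
  (hkmax : kmax = ereal_sup [set (ev (kappaU xy.2) xy.1)%:E
                            | xy in D `*` param_box])
  (hkbounds : (theta%:E < kmin /\ kmin <= kmax /\ kmax < (Theta / 2)%:E)%E)
  (u : (nat -> R) -> V) (p : (nat -> R) -> Q)
  (hup : forall y, param_box y ->
     saddle_point_solution (a (kappaU y)) b f g (u y) (p y)) :
  let tu := fun nu => `|taylor_coef u nu| in
  let tp := fun nu => `|taylor_coef p nu| in
  exists Lu Lp : nat -> {fset multi_index},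
    [/\ largest_index_sets tu Lu,
        largest_index_sets tp Lp,
        (forall s : R, 0 < s < 1 ->
           (\sum_(0 <= j <oo) (`|kappa j| `^ s)%:E < +oo)%E ->
           [/\ (lm_norm s tu < +oo)%E, (lm_norm s tp < +oo)%E &
               forall N, (1 <= N)%N ->
                 (taylor_error u (Lu N)
                    <= lm_norm s tu * (N%:R `^ (- rate s))%:E)%E /\
                 (taylor_error p (Lp N)
                    <= lm_norm s tp * (N%:R `^ (- rate s))%:E)%E]) &
        (forall (rho : nat -> R) (eps t : R),
           (forall j, 1 < rho j) ->
           (forall x, D x ->
              (\sum_(0 <= j <oo) (rho j * `|ev (kappa j) x|)%:E
                 <= (ev kappa0 x - eps)%:E)%E) ->
           theta < eps -> (eps%:E < kmin)%E ->
           0 < t ->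
           (\sum_(0 <= j <oo) ((rho j)^-1 `^ t)%:E < +oo)%E ->
           t < 1 ->
           [/\ (lm_norm t tu < +oo)%E, (lm_norm t tp < +oo)%E &
               forall N, (1 <= N)%N ->
                 (taylor_error u (Lu N)
                    <= lm_norm t tu * (N%:R `^ (- rate t))%:E)%E /\
                 (taylor_error p (Lp N)
                    <= lm_norm t tp * (N%:R `^ (- rate t))%:E)%E])].

Proof.
have d0 : (0 < d)%N by case: hd => ->.
case: hkbounds => hk1 [_ hk2].
exact: (best_N_term_rates d0 hKfun habsK hgamma halpha hdelta hbeta htheta hC1
  hthetaTheta ha hb hbinfsup haff ha1_upper ha1_abs hkappa hkmin hkmax hk1 hk2 hup).
Qed.
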